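(* Let $\{S_i\}_{i\in\mathcal I}$ be an IFS in the Lalley-Gatzouras class or in the Barański class, let $C\subseteq[0,1]^2$ be a non-empty compact set, let $F_\emptyset$ be the homogeneous attractor and let $F_C$ be the inhomogeneous attractor with condensation set $C$. Assume that $$\dim_{\mathrm A}\pi_i(C)\ \le\ \max\{\overline{s}_i(C),\,s_i(F_\emptyset)\}\qquad\text{for } i=1,2. \qquad (\mathrm A)$$ (a) If the IFS is in the Lalley-Gatzouras class, then $$\max\{\underline{s}_A,\underline{\dim}_{\mathrm B}C\}\ \le\ \underline{\dim}_{\mathrm B}F_C\ \le\ \overline{\dim}_{\mathrm B}F_C\ =\ \max\{\overline{s}_A,\overline{\dim}_{\mathrm B}C\}.$$ (b) If the IFS is in the Barański class, then $$\max\{\underline{s}_A,\underline{s}_B,\underline{\dim}_{\mathrm B}C\}\ \le\ \underline{\dim}_{\mathrm B}F_C\ \le\ \overline{\dim}_{\mathrm B}F_C\ =\ \max\{\overline{s}_A,\overline{s}_B,\overline{\dim}_{\mathrm B}C\}.$$ Furthermore, if (A) is not assumed, the same results hold with the final equalities replaced by ''$\ge$'': in the Lalley-Gatzouras case $\max\{\underline{s}_A,\underline{\dim}_{\mathrm B}C\}\le\underline{\dim}_{\mathrm B}F_C\le\overline{\dim}_{\mathrm B}F_C$ and $\overline{\dim}_{\mathrm B}F_C\ge\max\{\overline{s}_A,\overline{\dim}_{\mathrm B}C\}$; in the Barański case $\max\{\underline{s}_A,\underline{s}_B,\underline{\dim}_{\mathrm B}C\}\le\underline{\dim}_{\mathrm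 B}F_C\le\overline{\dim}_{\mathrm B}F_C$ and $\overline{\dim}_{\mathrm B}F_C\ge\max\{\overline{s}_A,\overline{s}_B,\overline{\dim}_{\mathrm B}C\}$.
   Context: IFS: $\mathcal I$ is a finite index set with $|\mathcal I|\ge 2$, and $S_i(x,y)=(c_ix,d_iy)+t_i$ are maps of $[0,1]^2$ into itself with $c_i,d_i\in(0,1)$, $t_i\in\mathbb R^2$. Lalley-Gatzouras class: divide the unit square into columns by a finite positive number of vertical lines; divide each column independently by slicing horizontally; select a subset of the resulting rectangles such that each selected rectangle has base length greater than or equal to its height (equality is allowed); for each selected rectangle include exactly one map $S_i$ of the form $S_i(x,y)=(c_ix,d_iy)+t_i$ with $c_i,d_i\in(0,1)$ and $t_i\in\mathbb R^2$, mapping the unit square onto that rectangle. So $c_i\ge d_i$ for all $i$. Barański class: divide the unit square into subrectangles by slicing all the way across, horizontally and vertically, a finite number of times (at least once in each direction); select a subset of the subrectangles, containing at least one whose horizontal side is strictly longer than its vertical side and at least one whose vertical side is strictly longer than its horizontal side; for each selected rectangle include exactly one map $S_i$ of the form $S_i(x,y)=(c_ix,d_iy)+t_i$ with $c_i,d_i\in(0,1)$ and $t_i\in\mathbb R^2$, mapping the unit square onto that rectangle. Attractors: $F_\emptyset$ is the unique non-empty compact set with $F_\emptyset=\bigcup_{i\in\mathcal I}S_i(F_\emptyset)$; $F_C$ is the unique non-empty compact set with $F_C=\bigcup_{i\in\mathcal I}S_i(F_C)\cup C$. Dimensions: $\underline{\dim}_{\mathrm B}$, $\overline{\dim}_{\mathrm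 B}$ are the lower and upper box dimensions, and $\dim_{\mathrm B}$ is the box dimension when they agree. The Assouad dimension $\dim_{\mathrm A}F$ is the infimum of $\alpha$ for which there exist $K,\rho>0$ such that for all $0<r<R\le\rho$, $\sup_{x\in F}N_r(B(x,R)\cap F)\le K(R/r)^\alpha$, where $N_r(E)$ is the smallest number of sets required for an $r$-cover of $E$. Projections: $\pi_1,\pi_2$ are the orthogonal projections of the plane onto the first and second coordinates. For $j=1,2$: $s_j(F_\emptyset)=\dim_{\mathrm B}\pi_j(F_\emptyset)$ (this exists), $\underline{s}_j(C)=\underline{\dim}_{\mathrm B}\pi_j(C)$, $\overline{s}_j(C)=\overline{\dim}_{\mathrm B}\pi_j(C)$. Exponents: put $\underline{t}_j=\max\{s_j(F_\emptyset),\underline{s}_j(C)\}$ and $\overline{t}_j=\max\{s_j(F_\emptyset),\overline{s}_j(C)\}$. Then $\underline{s}_A,\overline{s}_A,\underline{s}_B,\overline{s}_B$ are the unique real solutions of $$\sum_{i\in\mathcal I}c_i^{\underline t_1}d_i^{\underline s_A-\underline t_1}=1,\quad \sum_{i\in\mathcal I}c_i^{\overline t_1}d_i^{\overline s_A-\overline t_1}=1,\quad \sum_{i\in\mathcal I}d_i^{\underline t_2}c_i^{\underline s_B-\underline t_2}=1,\quad \sum_{i\in\mathcal I}d_i^{\overline t_2}c_i^{\overline s_B-\overline t_2}=1.$$ *)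

(* Defs.v *)
From HB Require Import structures.
From mathcomp Require Import all_boot all_order all_algebra.
From mathcomp Require Import all_classical all_reals all_analysis.

Set Implicit Arguments.
Unset Strict Implicit.
Unset Printing Implicit Defensive.

Import Order.TTheory GRing.Theory Num.Theory.
Import numFieldNormedType.Exports.

Local Open Scope classical_set_scope.
Local Open Scope ring_scope.

(* The canonical uniform structure of R * R is that of the sup norm, so metric
   notions take the distance explicitly: [line_dist] on R and the Euclidean
   [plane_dist] on R * R. *)
Definition line_dist (R : realType) (x y : R) : R := `|x - y|.

Definition plane_dist (R : realType) (p q : R * R) : R :=
  Num.sqrt ((p.1 - q.1) ^+ 2 + (p.2 - q.2) ^+ 2).

Section dimensions.
Variables (R : realType) (T : Type) (dist : T -> T -> R).
Implicit Types (E : set T) (r : R).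

(* [E] is covered by [k] sets of diameter at most [r]. *)
Definition has_cover r E (k : nat) : Prop :=
  exists U : 'I_k -> set T,
    (forall j x y, U j x -> U j y -> dist x y <= r) /\
    E `<=` \bigcup_(j in [set: 'I_k]) U j.

(* +oo if there is no finite cover. *)
Definition covering_number r E : \bar R :=
  ereal_inf [set (k%:R)%:E | k in has_cover r E].

Definition lower_box_dim E : \bar R :=
  limf_einf (fun r : R => lne (covering_number r E) / (- ln r)%:E)%E 0^'+.

Definition upper_box_dim E : \bar R :=
  limf_esup (fun r : R => lne (covering_number r E) / (- ln r)%:E)%E 0^'+.

(* The common value of the two when they agree and are finite (arbitrary
   otherwise). *)
Definition box_dim E : R :=
  get [set s : R | lower_box_dim E = s%:E /\ upper_box_dim E = s%:E].

Definition dist_ball (x : T) r : set T := [set y | dist x y <= r].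

Definition assouad_dim E : \bar R :=
  ereal_inf [set a%:E | a in [set a : R | exists K rho : R,
    [/\ 0 < K, 0 < rho & forall r r' : R, 0 < r -> r < r' -> r' <= rho ->
      (ereal_sup [set covering_number r (dist_ball x r' `&` E) | x in E]
         <= (K * (r' / r) `^ a)%:E)%E]]].

End dimensions.

Definition unit_square (R : realType) : set (R * R) := `[0, 1] `*` `[0, 1].

Definition diag_map (R : realType) (c d : R) (t : R * R) (p : R * R) : R * R :=
  (c * p.1 + t.1, d * p.2 + t.2).

Record diagonal_ifs (R : realType) (I : finType) := DiagonalIFS {
  hscale : I -> R;
  vscale : I -> R;
  shift : I -> R * R;
  hscale_range : forall i, 0 < hscale i < 1;
  vscale_range : forall i, 0 < vscale i < 1;
  diag_ifs_square : forall i,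
    diag_map (hscale i) (vscale i) (shift i) @` @unit_square R
      `<=` @unit_square R
}.

Definition ifs_map (R : realType) (I : finType) (S : diagonal_ifs R I) (i : I) :
    R * R -> R * R :=
  diag_map (hscale S i) (vscale S i) (shift S i).

(* With [C = set0] this is the homogeneous attractor. *)
Definition is_attractor (R : realType) (I : finType) (S : diagonal_ifs R I)
    (C F : set (R * R)) : Prop :=
  [/\ F !=set0, compact F &
      F = (\bigcup_(i in [set: I]) (ifs_map S i @` F)) `|` C].

Section slicing.
Variable R : realType.
Implicit Types (s : seq R) (k : nat).

(* The finite list [s] of cut points satisfies 0 < s_0 < s_1 < ... < 1; it cuts
   [0, 1] into [(size s).+1] closed intervals [slice s k], [k <= size s]. *)
Definition is_slicing s : bool := path <%R 0 (rcons s 1).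

Definition slice_point s k : R := nth 1 (0 :: rcons s 1) k.

Definition slice s k : set R := `[slice_point s k, slice_point s k.+1].

Definition slice_length s k : R := slice_point s k.+1 - slice_point s k.

End slicing.

(* [v] lists the abscissae of the vertical lines, [h k] the ordinates of the
   horizontal cuts of column [k] (possibly none), and [f i] is the position
   (column, row within the column) of the rectangle selected for the map [i].
   The selection is the range of [f]; injectivity of [f] says that each
   selected rectangle carries exactly one map. *)
Definition lalley_gatzouras (R : realType) (I : finType)
    (S : diagonal_ifs R I) : Prop :=
  exists (v : seq R) (h : nat -> seq R) (f : I -> nat * nat),
    [/\ (0 < size v)%N /\ is_slicing v,
        forall k, (k <= size v)%N -> is_slicing (h k),
        injective f,
        forall i, ((f i).1 <= size v)%N /\ ((f i).2 <= size (h (f i).1))%N &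
        forall i,
          slice_length (h (f i).1) (f i).2 <= slice_length v (f i).1 /\
          ifs_map S i @` @unit_square R =
            slice v (f i).1 `*` slice (h (f i).1) (f i).2].

Definition baranski (R : realType) (I : finType)
    (S : diagonal_ifs R I) : Prop :=
  exists (v h : seq R) (f : I -> nat * nat),
    [/\ [/\ (0 < size v)%N, is_slicing v, (0 < size h)%N & is_slicing h],
        injective f,
        forall i, [/\ ((f i).1 <= size v)%N, ((f i).2 <= size h)%N &
          ifs_map S i @` @unit_square R = slice v (f i).1 `*` slice h (f i).2],
        exists i, slice_length h (f i).2 < slice_length v (f i).1 &
        exists i, slice_length v (f i).1 < slice_length h (f i).2].

(* The unique real [s] with \sum_i a_i ^ t * b_i ^ (s - t) = 1. *)
Definition pressure_root (R : realType) (I : finType) (a b : I -> R) (t : R) :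
    R :=
  get [set s : R | \sum_(i : I) a i `^ t * b i `^ (s - t) = 1].

Section exponents.
Variables (R : realType) (I : finType) (S : diagonal_ifs R I).
Variables (F0 C : set (R * R)).
Implicit Type p : R * R -> R.

(* [p] is one of the projections [fst], [snd]; F0 is the homogeneous attractor.
   The box dimensions of bounded non-empty sets are finite, whence [fine]. *)
Definition t_lower p : R :=
  Num.max (box_dim (@line_dist R) (p @` F0))
          (fine (lower_box_dim (@line_dist R) (p @` C))).

Definition t_upper p : R :=
  Num.max (box_dim (@line_dist R) (p @` F0))
          (fine (upper_box_dim (@line_dist R) (p @` C))).

Definition sA_lower : R := pressure_root (hscale S) (vscale S) (t_lower fst).
Definition sA_upper : R := pressure_root (hscale S) (vscale S) (t_upper fst).
Definition sB_lower : R := pressure_root (vscale S) (hscale S) (t_lower snd).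
Definition sB_upper : R := pressure_root (vscale S) (hscale S) (t_upper snd).

Definition assouad_condition p : Prop :=
  (assouad_dim (@line_dist R) (p @` C) <=
     maxe (upper_box_dim (@line_dist R) (p @` C))
          (box_dim (@line_dist R) (p @` F0))%:E)%E.

End exponents.

(* Main.v *)
Require Import Defs.
From HB Require Import structures.
From mathcomp Require Import all_boot all_order all_algebra.
From mathcomp Require Import all_classical all_reals all_analysis.
From mathcomp Require Import ring lra.

Set Implicit Arguments.
Unset Strict Implicit.
Unset Printing Implicit Defensive.

Import Order.TTheory GRing.Theory Num.Theory.
Import numFieldNormedType.Exports.

Local Open Scope classical_set_scope.
Local Open Scope ring_scope.

(** The lower bounds come from packing congruent rectangles, the upper bound from
    a recursion over cylinders.

    Lower bounds. Suppose that F_C contains N affine copies of itself whose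
    rectangles all have width c and height d, with d <= c, and have disjoint
    interiors. A set of diameter at most d meets at most 16 of these rectangles
    ([rectangles_met]), and the part of a cover that meets one copy covers, once
    projected, pi_1 F_C at scale d / c. Hence N times the covering number of
    pi_1 F_C at scale d / c is at most 16 times that of F_C at scale d
    ([packing]). This applies to the k-th power of the family, whose parameters
    are N^k, c^k and d^k, so that N c^t d^(s - t) >= 1 forces the dimension of
    F_C to be at least s whenever that of pi_1 F_C is at least t. The argument
    works for the lower and for the upper box dimension, because all the copies
    query the projection at one and the same scale, which can be taken in
    any given sequence.

    Such families are extracted from the system by expanding the n-th power of
    sum_i c_i^x d_i^(s - x), a number larger than 1: the words of length n fall
    into polynomially many permutation classes, so one class carries a total
    weight at least 1, and the rectangles of a class are congruent
    ([heavy_permutation_class], [homogeneous_subsystem]). In the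
    Lalley-Gatzouras class every rectangle is wide and x = t_1 gives s_A. In the
    Baranski class the rectangles obtained may be wide or tall. Whenever
    s - t_2 <= x <= t_1, the weight c^x d^(s - x) is at most c^(t_1) d^(s - t_1)
    if c >= d and at most d^(t_2) c^(s - t_2) otherwise, so that both cases give
    the dimension s ([tilted_pressure_bound]). The choices x = t_1 and
    x = s - t_2, which correspond to s_A and s_B, are in this range because
    s_A and s_B are at most t_1 + t_2: the sum of c_i^(t_1) d_i^(t_2) is bounded
    by the product of a sum over columns and a sum over rows ([grid_sum_le1]).

    Upper bound. Let u exceed t_1 and beta exceed both s_A and the upper box
    dimension of C, with u close enough to t_1 for the sum of
    c_i^u d_i^(beta - u) to be less than 1. At scale delta, the copies of F_C in
    rectangles of height about delta are covered through pi_1 F_C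
    ([thin_coverable]), and the copies of C in higher ones through the pieces of
    a cover of C, each of which is stretched horizontally and is controlled by
    the Assouad dimension of pi_1 C ([stretched_coverable]). Both costs are
    bounded by a multiple of delta^(- beta) c^u d^(beta - u), and these weights
    are contracted when a rectangle is replaced by its children, so the total
    cost is a geometric series ([cylinder_covering]). In the Baranski class the
    sum of the two weights, for wide and for tall rectangles, plays this part.

    The box dimension of pi_j F_0 is the similarity dimension of the system of
    distinct columns; both inequalities are one-dimensional instances of the two
    arguments above ([column_box_dim]). *)

(** * Box dimensions in terms of covers *)

Lemma powRDp (R : realType) (r x y : R) : 0 < r ->
  r `^ (x + y) = r `^ x * r `^ y.
Proof. by move=> r0; rewrite powRD//; apply/implyP => _; rewrite gt_eqF. Qed.

Section covering.
Variables (R : realType) (T : Type) (dist : T -> T -> R).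
Implicit Types (E : set T) (r x b : R).

Definition coverable r E x : Prop :=
  exists2 k, has_cover dist r E k & k%:R <= x.

Definition cover_needs r E x : Prop :=
  forall k, has_cover dist r E k -> x <= k%:R.

Lemma covering_number_ge r E x :
  (x%:E <= covering_number dist r E)%E <-> cover_needs r E x.
Proof.
split=> [h k hk|h].
  by rewrite -lee_fin (le_trans h)//; apply: ereal_inf_lbound; exists k.
by apply: le_ereal_inf_tmp => _ [k hk <-]; rewrite lee_fin; exact: h.
Qed.

(** The infimum is attained, being over a set of integers. *)
Lemma covering_number_le r E x :
  (covering_number dist r E <= x%:E)%E <-> coverable r E x.
Proof.
split=> [h|[k hk kx]]; last first.
  apply: le_trans (_ : (k%:R%:E <= _)%E); last by rewrite lee_fin.
  by apply: ereal_inf_lbound; exists k.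
have [k0 hk0] : exists k, has_cover dist r E k.
  have : (covering_number dist r E < +oo)%E by rewrite (le_lt_trans h) ?ltry.
  by move/ereal_inf_lt => [_ [k hk _] _]; exists k.
have hex : exists k, `[< has_cover dist r E k >] by exists k0; exact/asboolP.
case: (ex_minnP hex) => k /asboolP hk kmin; exists k => //.
rewrite -lee_fin (le_trans _ h)//.
by apply/covering_number_ge => j /asboolP /kmin; rewrite ler_nat.
Qed.

Lemma covering_number_ge0 r E : (0 <= covering_number dist r E)%E.
Proof. by apply/covering_number_ge => k _. Qed.

(** For [r < 1] the denominator is positive, and a bound [b] on the quotient
    that defines the box dimensions is the bound [r `^ (- b)] on the covering
    number. *)
Lemma box_quotient_le r E b : 0 < r < 1 ->
  (lne (covering_number dist r E) / (- ln r)%:E <= b%:E)%E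
  = (covering_number dist r E <= (r `^ (- b))%:E)%E.
Proof.
move=> /andP[r0 r1].
have lr : 0 < - ln r by rewrite oppr_gt0 ln_lt0// r0.
rewrite inver gt_eqF// lee_pdivrMr// -EFinM -[RHS]lee_lne.
- by rewrite lne_EFin ?powR_gt0// ln_powR mulrN mulNr.
- by rewrite in_itv/= covering_number_ge0 leey.
- by rewrite in_itv/= lee_fin powR_ge0 leey.
Qed.

Lemma box_quotient_ge r E b : 0 < r < 1 ->
  (b%:E <= lne (covering_number dist r E) / (- ln r)%:E)%E
  = ((r `^ (- b))%:E <= covering_number dist r E)%E.
Proof.
move=> /andP[r0 r1].
have lr : 0 < - ln r by rewrite oppr_gt0 ln_lt0// r0.
rewrite inver gt_eqF// leNgt lte_pdivrMr// -leNgt -EFinM -[RHS]lee_lne.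
- by rewrite lne_EFin ?powR_gt0// ln_powR mulrN mulNr.
- by rewrite in_itv/= lee_fin powR_ge0 leey.
- by rewrite in_itv/= covering_number_ge0 leey.
Qed.

Let small (r0 : R) : 0 < r0 -> exists2 V, (0^'+ : set (set R)) V &
  forall r, V r -> 0 < r < Num.min r0 1.
Proof.
move=> r00; exists [set r : R | 0 < r < Num.min r0 1] => //.
near=> r; apply/andP; split; near: r; first exact: nbhs_right_gt.
by apply: nbhs_right_lt; rewrite lt_min r00 ltr01.
Unshelve. all: by end_near. Qed.

Let nbhs_right_min (V : set R) : (0^'+ : set (set R)) V ->
  exists2 r0 : R, 0 < r0 & forall r, 0 < r < r0 -> V r.
Proof.
move=> /nbhs_right0P /nbhs_ballP[e /= e0 h]; exists e => // r /andP[r0 re].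
have := h r; rewrite /ball/= sub0r normrN gtr0_norm// add0r; exact.
Qed.

Lemma lower_le_upper_box_dim E :
  (lower_box_dim dist E <= upper_box_dim dist E)%E.
Proof.
rewrite /lower_box_dim /upper_box_dim limf_einfE limf_esupE.
apply: ge_ereal_sup => _ [V FV <-]; apply: le_ereal_inf_tmp => _ [W FW <-].
have [x [Vx Wx]] := @filter_ex _ _ (at_right_proper_filter (0 : R)) _
  (filterI FV FW).
apply: (@le_trans _ _ (lne (covering_number dist x E) / (- ln x)%:E)%E).
  by apply: ereal_inf_lbound; exists x.
by apply: ereal_sup_ubound; exists x.
Qed.

Lemma upper_box_dim_lt E b : (upper_box_dim dist E < b%:E)%E ->
  exists2 r0 : R, 0 < r0 & forall r, 0 < r < r0 -> coverable r E (r `^ (- b)).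
Proof.
rewrite /upper_box_dim limf_esupE => /ereal_inf_lt[_ [V FV <-]] hV.
have [r0 r00 h] := nbhs_right_min FV.
exists (Num.min r0 1); first by rewrite lt_min r00 ltr01.
move=> r /andP[rpos]; rewrite lt_min => /andP[rr0 r1].
apply/covering_number_le; rewrite -box_quotient_le ?rpos//.
apply: le_trans (ltW hV); apply: ereal_sup_ubound; exists r => //.
by apply: h; rewrite rpos.
Qed.

Lemma lower_box_dim_gt E b : (b%:E < lower_box_dim dist E)%E ->
  exists2 r0 : R, 0 < r0 & forall r, 0 < r < r0 -> cover_needs r E (r `^ (- b)).
Proof.
rewrite /lower_box_dim limf_einfE => /ereal_sup_gt[_ [V FV <-]] hV.
have [r0 r00 h] := nbhs_right_min FV.
exists (Num.min r0 1); first by rewrite lt_min r00 ltr01.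
move=> r /andP[rpos]; rewrite lt_min => /andP[rr0 r1].
apply/covering_number_ge; rewrite -box_quotient_ge ?rpos//.
apply: le_trans (ltW hV) _; apply: ereal_inf_lbound; exists r => //.
by apply: h; rewrite rpos.
Qed.

Lemma upper_box_dim_gt E b : (b%:E < upper_box_dim dist E)%E ->
  forall r0 : R, 0 < r0 ->
  exists2 r, 0 < r < r0 & cover_needs r E (r `^ (- b)).
Proof.
rewrite /upper_box_dim limf_esupE => hb r0 r00.
have [V FV hV] := small r00.
have : (b%:E < ereal_sup [set lne (covering_number dist r E)
    / (- ln r)%:E | r in V])%E.
  by apply: lt_le_trans hb _; apply: ereal_inf_lbound; exists V.
move=> /ereal_sup_gt[_ [r Vr <-]] /ltW.
have /andP[rpos] := hV _ Vr; rewrite lt_min => /andP[rr0 r1].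
rewrite box_quotient_ge ?rpos// => /covering_number_ge h.
by exists r; rewrite // rpos.
Qed.

(** A multiplicative constant is absorbed by any loss in the exponent. *)
Lemma powR_absorb (K e : R) : 0 < K -> 0 < e ->
  exists2 r0 : R, 0 < r0 & forall r, 0 < r < r0 -> K * r `^ e <= 1.
Proof.
move=> K0 e0; exists (K `^ (- e^-1)); first exact: powR_gt0.
move=> r /andP[rpos rr0].
have /ler_wpM2l : r `^ e <= K^-1; last first.
  by move=> /(_ K (ltW K0)); rewrite divff ?gt_eqF.
rewrite -(powR_inv1 (ltW K0)) -[leRHS]/(K `^ (- 1)).
have -> : K `^ (-1) = (K `^ (- e^-1)) `^ e.
  by rewrite -powRrM mulNr mulVf// gt_eqF.
by rewrite ge0_ler_powR ?nnegrE ?powR_ge0 ?ltW.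
Qed.

Lemma upper_box_dim_le E (K r0 b : R) : 0 < K -> 0 < r0 ->
  (forall r, 0 < r < r0 -> coverable r E (K * r `^ (- b))) ->
  (upper_box_dim dist E <= b%:E)%E.
Proof.
move=> K0 r00 h; apply/lee_addgt0Pr => e e0.
have [r1 r10 h1] := powR_absorb K0 e0.
have [V FV hV] := @small (Num.min r0 r1) ltac:(by rewrite lt_min r00).
rewrite /upper_box_dim limf_esupE.
apply: (@le_trans _ _ (ereal_sup [set lne (covering_number dist r E)
    / (- ln r)%:E | r in V])%E); first by apply: ereal_inf_lbound; exists V.
apply: ge_ereal_sup => _ [r Vr <-].
have /andP[rpos] := hV _ Vr; rewrite !lt_min => /andP[/andP[rr0 rr1] rlt1].
rewrite -EFinD box_quotient_le ?rpos//; apply/covering_number_le.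
have [k hk kle] := h r ltac:(by rewrite rpos).
exists k => //; apply: (le_trans kle).
have -> : r `^ (- b) = r `^ e * r `^ (- (b + e)).
  by rewrite -powRDp//; congr powR; ring.
rewrite mulrA ler_piMl ?powR_ge0//.
by apply: h1; rewrite rpos.
Qed.

Lemma lower_box_dim_ge E (K r0 b : R) : 0 < K -> 0 < r0 ->
  (forall r, 0 < r < r0 -> cover_needs r E (K * r `^ (- b))) ->
  (b%:E <= lower_box_dim dist E)%E.
Proof.
move=> K0 r00 h; apply/lee_addgt0Pr => e e0.
rewrite -leeBlDr// -EFinB.
have [r1 r10 h1] := @powR_absorb K^-1 e ltac:(by rewrite invr_gt0) e0.
have [V FV hV] := @small (Num.min r0 r1) ltac:(by rewrite lt_min r00).
rewrite /lower_box_dim limf_einfE.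
apply: (@le_trans _ _ (ereal_inf [set lne (covering_number dist r E)
    / (- ln r)%:E | r in V])%E); last by apply: ereal_sup_ubound; exists V.
apply: le_ereal_inf_tmp => _ [r Vr <-].
have /andP[rpos] := hV _ Vr; rewrite !lt_min => /andP[/andP[rr0 rr1] rlt1].
rewrite box_quotient_ge ?rpos//; apply/covering_number_ge => k hk.
apply: le_trans (h r ltac:(by rewrite rpos) k hk).
have -> : r `^ (- (b - e)) = r `^ e * r `^ (- b).
  by rewrite -powRDp//; congr powR; ring.
rewrite ler_wpM2r ?powR_ge0// -(ler_pM2l (_ : 0 < K^-1)) ?invr_gt0//.
by rewrite mulVf ?gt_eqF//; apply: h1; rewrite rpos.
Qed.

(** If the dimension were less than some [c < b], then the covering numbers
    would be at most [r `^ (- c)], which is eventually less than [K * r `^ (-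
    b)]. *)
Lemma upper_box_dim_ge E (K b : R) : 0 < K ->
  (forall r0 : R, 0 < r0 ->
     exists2 r, 0 < r < r0 & cover_needs r E (K * r `^ (- b))) ->
  (b%:E <= upper_box_dim dist E)%E.
Proof.
move=> K0 h; rewrite leNgt; apply/negP => hlt.
have [c /andP[hc cb]] : exists c : R, (upper_box_dim dist E < c%:E)%E && (c < b).
  move: hlt; case: (upper_box_dim dist E) => [u| |] //.
    by rewrite lte_fin => ub; exists ((u + b) / 2); rewrite lte_fin !midf_lt.
  by move=> _; exists (b - 1); rewrite ltNyr/= ltrBlDr ltrDl.
have [r0 r00 hr0] := upper_box_dim_lt hc.
have [r1 r10 hr1] := @powR_absorb (2 / K) (b - c)
  ltac:(by rewrite divr_gt0) ltac:(by rewrite subr_gt0).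
have [r /andP[rpos]] := h (Num.min r0 r1) ltac:(by rewrite lt_min r00).
rewrite lt_min => /andP[rr0 rr1] hneed.
have [k hk kle] := hr0 r ltac:(by rewrite rpos).
have := hr1 r ltac:(by rewrite rpos).
have := le_trans (hneed k hk) kle.
have -> : r `^ (- b) = (r `^ (b - c))^-1 * r `^ (- c).
  by rewrite -powRN -powRDp//; congr powR; ring.
rewrite mulrA ger_pMl ?powR_gt0// ler_pdivrMr ?powR_gt0// mul1r => h1.
rewrite mulrAC ler_pdivrMr// mul1r => h2.
have := powR_gt0 (b - c) rpos.
lra.
Qed.

End covering.

(** * Operations on covers *)

Lemma expr_lt (R : realType) (d e : R) : 0 < d < 1 -> 0 < e ->
  exists n, d ^+ n < e.
Proof.
move=> /andP[d0 d1] e0.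
have /cvgrPdist_lt /(_ _ e0) [n _ h] : d ^+ n @[n --> \oo] --> (0 : R).
  by apply: cvg_expr; rewrite gtr0_norm.
exists n; have := h n (leqnn n).
by rewrite /= sub0r normrN gtr0_norm// exprn_gt0.
Qed.

Lemma geometric_bracket (R : realType) (d r : R) : 0 < d < 1 -> 0 < r <= 1 ->
  exists k, d ^+ k.+1 <= r <= d ^+ k.
Proof.
move=> d01 /andP[r0 r1]; have [n /ltW hn] := expr_lt d01 r0.
have [[|k] hk kmin] := ex_minnP (ex_intro (fun n => d ^+ n <= r) n hn).
  have -> : r = 1 by apply/le_anti; rewrite r1 -(expr0 d).
  by exists 0%N; rewrite expr1 expr0 lexx andbT ltW//; case/andP: d01.
exists k; rewrite hk/= leNgt; apply/negP => /ltW /kmin.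
by rewrite ltnn.
Qed.

(** Gives constants that bound the powers of a bounded ratio whatever the sign
    of the exponent. *)
Lemma powR_ge_abs (R : realType) (m r x : R) : 0 < m -> m <= r <= 1 ->
  m `^ `|x| <= r `^ x.
Proof.
move=> m0 /andP[mr r1]; have r0 := lt_le_trans m0 mr.
apply: (@le_trans _ _ (r `^ `|x|)).
  by rewrite ge0_ler_powR ?nnegrE// ltW.
by apply: ger_powR; rewrite ?r0 ?ler_norm.
Qed.

Lemma powR_le_abs (R : realType) (m r x : R) : 0 < m -> m <= r <= 1 ->
  r `^ x <= m `^ (- `|x|).
Proof.
move=> m0 mr; have r0 : 0 < r by case/andP: mr => /(lt_le_trans m0).
have -> : r `^ x = (r `^ (- x))^-1 by rewrite -powRN opprK.
rewrite [leRHS]powRN lef_pV2 ?posrE ?powR_gt0//.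
by rewrite -normrN powR_ge_abs.
Qed.

Section cover_operations.
Variables (R : realType) (T : Type) (dist : T -> T -> R).
Implicit Types (E : set T) (r x b : R).

Local Notation coverable := (coverable dist).
Local Notation cover_needs := (cover_needs dist).

Lemma coverable_mono r r' E E' x x' : r <= r' -> E' `<=` E -> x <= x' ->
  coverable r E x -> coverable r' E' x'.
Proof.
move=> rr' EE' xx' [k [U [hU EU]] kx]; exists k; last exact: le_trans xx'.
exists U; split; last exact: subset_trans EU.
by move=> j y z Uy Uz; apply: le_trans rr'; exact: hU Uy Uz.
Qed.

Lemma cover_needs_mono r r' E E' x x' : r' <= r -> E `<=` E' -> x' <= x ->
  cover_needs r E x -> cover_needs r' E' x'.
Proof.
move=> rr' EE' xx' h k [U [hU EU]]; apply: (le_trans xx'); apply: h.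
exists U; split; last exact: subset_trans EU.
by move=> j y z Uy Uz; apply: le_trans rr'; exact: hU Uy Uz.
Qed.

Lemma coverable_set0 r : coverable r set0 0.
Proof. by exists 0%N => //; exists (fun=> set0); split. Qed.

Lemma coverable1 r E : (forall y z, E y -> E z -> dist y z <= r) ->
  coverable r E 1.
Proof.
move=> h; exists 1%N => //; exists (fun=> E); split=> // y Ey.
by exists ord0.
Qed.

Lemma cover_needs1 r E : E !=set0 -> cover_needs r E 1.
Proof.
move=> [y Ey] [|k] [U [_ EU]]; last by rewrite ler1n.
by have [[]] := EU y Ey.
Qed.

Lemma coverableU r E E' x x' : coverable r E x -> coverable r E' x' ->
  coverable r (E `|` E') (x + x').
Proof.
move=> [k [U [hU EU]] kx] [k' [U' [hU' EU']] kx']; exists (k + k')%N; last first.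
  by rewrite natrD lerD.
exists (fun i => match fintype.split i with inl j => U j | inr j => U' j end); split.
  by move=> i y z; case: (fintype.split i) => j; [exact: hU | exact: hU'].
move=> y [/EU[j _ Uj]|/EU'[j _ Uj]].
  by exists (lshift k' j) => //; rewrite -[lshift _ _]/(unsplit (inl j)) unsplitK.
by exists (rshift k j) => //; rewrite -[rshift _ _]/(unsplit (inr j)) unsplitK.
Qed.

Lemma coverable_bigcup (J : finType) r (E : J -> set T) (x : J -> R) :
  (forall j, coverable r (E j) (x j)) ->
  coverable r (\bigcup_(j in [set: J]) E j) (\sum_j x j).
Proof.
move=> h; suff H (s : seq J) :
    coverable r (\bigcup_(j in [set` s]) E j) (\sum_(j <- s) x j).
  have := H (enum J); rewrite big_enum/=; apply: coverable_mono => // y [j _ Ey].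
  by exists j => //=; rewrite mem_enum.
elim: s => [|j s ih].
  rewrite big_nil; apply: coverable_mono (coverable_set0 r) => //.
  by move=> y [].
rewrite big_cons; apply: coverable_mono (coverableU (h j) ih) => //.
move=> y [i /=]; rewrite inE => /orP[/eqP ->|si] Ey; first by left.
by right; exists i.
Qed.

Lemma coverable_bigcup_ord r k (E : 'I_k -> set T) x y : 0 <= x ->
  (forall j, coverable r (E j) x) -> k%:R <= y ->
  coverable r (\bigcup_(j in [set: 'I_k]) E j) (y * x).
Proof.
move=> x0 h ky; have := coverable_bigcup h.
rewrite sumr_const card_ord -mulr_natl; apply: coverable_mono => //.
by rewrite ler_wpM2r.
Qed.

(** Scales that are not small cost a constant factor, because the power of [r]
    is at least one when [0 <= b]. *)
Lemma upper_box_dim_bound E b : 0 <= b -> (upper_box_dim dist E < b%:E)%E ->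
  exists2 K : R, 0 < K &
    forall r, 0 < r <= 1 -> coverable r E (K * r `^ (- b)).
Proof.
move=> b0 /upper_box_dim_lt[r0 r00 h].
pose r1 := r0 / 2; have r10 : 0 < r1 by rewrite divr_gt0.
exists (Num.max 1 (r1 `^ (- b))); first by rewrite lt_max ltr01.
move=> r /andP[rpos r_le1].
have [rr0|r0r] := ltP r r0.
  apply: coverable_mono (h r _); rewrite ?rpos//.
  by rewrite ler_peMl ?powR_ge0// le_max lexx.
apply: (@coverable_mono r1 _ E _ (r1 `^ (- b))) => //.
- by apply: le_trans r0r; rewrite /r1 ler_pdivrMr// mulr2n mulrDr mulr1 lerDl ltW.
- apply: (@le_trans _ _ (r1 `^ (- b) * 1)); first by rewrite mulr1.
  rewrite ler_pM ?powR_ge0// ?le_max ?lexx ?orbT//.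
  by rewrite -(powRr0 r); apply: ger_powR; rewrite ?rpos ?oppr_le0.
- by apply: h; rewrite r10 /r1 ltr_pdivrMr// mulr2n mulrDr mulr1 ltrDl.
Qed.

Lemma lower_box_dim_bound E b : E !=set0 -> (b%:E < lower_box_dim dist E)%E ->
  exists2 K : R, 0 < K &
    forall r, 0 < r <= 1 -> cover_needs r E (K * r `^ (- b)).
Proof.
move=> E0 /lower_box_dim_gt[r0 r00 h].
pose r1 := Num.min r0 1; have r10 : 0 < r1 by rewrite lt_min r00 ltr01.
exists (r1 `^ `|b|); first exact: powR_gt0.
move=> r /andP[rpos r_le1].
have r1b : r1 `^ `|b| <= 1.
  by rewrite -(powRr0 r1); apply: ger_powR; rewrite ?r10 ?ge_min ?lexx ?orbT.
have [rr0|r0r] := ltP r r0.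
  apply: cover_needs_mono (h r _); rewrite ?rpos//.
  by rewrite ler_piMl ?powR_ge0.
apply: (@cover_needs_mono r r E E 1) => //; last exact: cover_needs1.
rewrite powRN ler_pdivrMr ?powR_gt0// mul1r powR_ge_abs// r_le1 andbT.
by rewrite ge_min r0r.
Qed.

Lemma lower_box_dim_ge0 E : E !=set0 -> (0 <= lower_box_dim dist E)%E.
Proof.
move=> E0; apply: (@lower_box_dim_ge _ _ _ _ 1 1) => // r _.
by rewrite oppr0 powRr0 mulr1; exact: cover_needs1.
Qed.

(** Covering numbers are monotone in the scale, so bounds along a geometric
    sequence of scales suffice. *)
Lemma lower_box_dim_ge_geometric E (K d b : R) : 0 < K -> 0 < d < 1 ->
  (forall k, cover_needs (d ^+ k) E (K * (d ^+ k) `^ (- b))) ->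
  (b%:E <= lower_box_dim dist E)%E.
Proof.
move=> K0 d01 h; have /andP[d0 d1] := d01.
apply: (@lower_box_dim_ge _ _ _ _ (K * d `^ `|b|) 1) => //.
  by rewrite mulr_gt0 ?powR_gt0.
move=> r /andP[r0 r1].
have [k /andP[kr rk]] := @geometric_bracket _ d r d01 ltac:(by rewrite r0 ltW).
apply: cover_needs_mono (h k) => //; rewrite -mulrA ler_pM2l//.
have dk0 : 0 < d ^+ k by rewrite exprn_gt0.
have -> : r `^ (- b) = (d ^+ k) `^ (- b) * (r / d ^+ k) `^ (- b).
  by rewrite -powRM ?divr_ge0 ?ltW// mulrCA divff ?mulr1// gt_eqF.
rewrite mulrCA ler_piMr ?powR_ge0// powRN ler_pdivrMr ?powR_gt0 ?divr_gt0//.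
rewrite mul1r powR_ge_abs// ler_pdivlMr// ler_pdivrMr// mul1r rk andbT.
by rewrite -exprS.
Qed.

Lemma upper_box_dim_ge_geometric E (K d b : R) : 0 < K -> 0 < d < 1 ->
  (forall k0, exists2 k, (k0 <= k)%N &
     cover_needs (d ^+ k) E (K * (d ^+ k) `^ (- b))) ->
  (b%:E <= upper_box_dim dist E)%E.
Proof.
move=> K0 d01 h; have /andP[d0 d1] := d01.
apply: (upper_box_dim_ge K0) => r0 r00.
have [k0 hk0] := expr_lt d01 r00.
have [k kk0 hk] := h k0.
exists (d ^+ k) => //; rewrite exprn_gt0//= (le_lt_trans _ hk0)//.
by rewrite ler_wiXn2l// ltW.
Qed.

End cover_operations.

Lemma coverable_image (R : realType) (T T' : Type) (dist : T -> T -> R)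
    (dist' : T' -> T' -> R) (f : T -> T') (E : set T) (L r r' x : R) :
  0 <= L -> (forall y z, E y -> E z -> dist' (f y) (f z) <= L * dist y z) ->
  L * r <= r' -> coverable dist r E x -> coverable dist' r' (f @` E) x.
Proof.
move=> L0 fL rr' [k [U [hU EU]] kx]; exists k => //.
exists (fun j => f @` (U j `&` E)); split.
  move=> j _ _ [y [Uy Ey] <-] [z [Uz Ez] <-]; apply: le_trans rr'.
  by apply: le_trans (fL _ _ Ey Ez) _; rewrite ler_wpM2l// (hU j).
by move=> _ [y Ey <-]; have [j _ Uj] := EU _ Ey; exists j => //; exists y.
Qed.

Lemma cover_needs_image (R : realType) (T T' : Type) (dist : T -> T -> R)
    (dist' : T' -> T' -> R) (f : T -> T') (E : set T) (r x : R) :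
  (forall y z, dist' (f y) (f z) <= dist y z) ->
  cover_needs dist' r (f @` E) x -> cover_needs dist r E x.
Proof.
move=> fL h k hk.
have : coverable dist' r (f @` E) k%:R.
  apply: (@coverable_image _ _ _ dist dist' f E 1 r) => //.
  - by move=> y z _ _; rewrite mul1r.
  - by rewrite mul1r.
  - by exists k.
by move=> [j hj jk]; exact: le_trans (h _ hj) jk.
Qed.

Section line_and_plane.
Variable R : realType.
Implicit Types (p q : R * R) (E : set R).

Lemma plane_dist_fst p q : line_dist p.1 q.1 <= plane_dist p q.
Proof. by rewrite /line_dist /plane_dist -sqrtr_sqr ler_wsqrtr// lerDl sqr_ge0. Qed.

Lemma plane_dist_snd p q : line_dist p.2 q.2 <= plane_dist p q.
Proof. by rewrite /line_dist /plane_dist -sqrtr_sqr ler_wsqrtr// lerDr sqr_ge0. Qed.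

Lemma plane_dist_le p q (r : R) : `|p.1 - q.1| <= r -> `|p.2 - q.2| <= r ->
  plane_dist p q <= 2 * r.
Proof.
move=> h1 h2; have r0 : 0 <= r by exact: le_trans h1.
rewrite /plane_dist -[leRHS]ger0_norm ?mulr_ge0// -sqrtr_sqr ler_wsqrtr//.
rewrite -[_ ^+ 2 in leLHS]real_normK ?num_real// -[(p.2 - _) ^+ 2]real_normK ?num_real//.
have := normr_ge0 (p.1 - q.1); have := normr_ge0 (p.2 - q.2).
nra.
Qed.

Lemma interval_coverable (a L r : R) : 0 <= L -> 0 < r ->
  coverable (@line_dist R) r `[a, a + L] (L / r + 1).
Proof.
move=> L0 r0; pose n := Num.truncn (L / r).
have Lr0 : 0 <= L / r by rewrite divr_ge0 // ltW.
have /andP[hn1 hn2] := truncn_itv Lr0.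
exists n.+1; last by rewrite -natr1 lerD2r.
exists (fun j : 'I_n.+1 => [set` `[a + j%:R * r, a + j%:R * r + r]]); split.
  move=> j y z /=; rewrite !in_itv/= /line_dist => /andP[? ?] /andP[? ?].
  by rewrite ler_norml; apply/andP; split; lra.
move=> y /=; rewrite in_itv/= => /andP[ay ya].
pose u := (y - a) / r.
have u0 : 0 <= u by rewrite divr_ge0 ?subr_ge0// ltW.
have /andP[hu1 hu2] := truncn_itv u0.
have uy : u * r = y - a by rewrite /u divfK// gt_eqF.
have ulen : (Num.truncn u < n.+1)%N.
  by rewrite ltnS le_truncn// ler_pM2r ?invr_gt0// lerBlDl.
exists (Ordinal ulen) => //=; rewrite in_itv/=.
move: hu1 hu2; rewrite -natr1 -(ler_pM2r r0) -(ltr_pM2r r0) uy mulrDl mul1r.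
by move=> ? ?; apply/andP; split; lra.
Qed.

Lemma upper_box_dim_unit_interval E : E `<=` `[0, 1] ->
  (upper_box_dim (@line_dist R) E <= 1%:E)%E.
Proof.
move=> E01; apply: (@upper_box_dim_le _ _ _ _ 2 1) => // r /andP[r0 r1].
apply: coverable_mono (@interval_coverable 0 1 r ler01 r0) => //.
  by rewrite add0r.
rewrite (powR_inv1 (ltW r0)) div1r.
have : 1 <= r^-1 by rewrite invf_ge1// ltW.
lra.
Qed.

End line_and_plane.

(** * Covering by recursion over cylinders *)

Lemma powR_invr (R : realType) (x t : R) : 0 <= x -> x^-1 `^ t = x `^ (- t).
Proof. by move=> x0; rewrite -(powR_inv1 x0) -powRrM mulN1r. Qed.

(** An element of [A] encodes a cylinder, [Fc] and [Cc] its copies of the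
    attractor and of the condensation set. The constant satisfies [theta * K +
    KC <= K], so the bound for a cylinder follows from the bounds for its
    children and for its copy of the condensation set; the recursion stops when
    the size is below [delta]. *)
Lemma cylinder_covering (R : realType) (T : Type) (dist : T -> T -> R)
    (I : finType) (A : Type) (P : A -> Prop) (size phi : A -> R)
    (child : A -> I -> A) (Fc Cc : A -> set T) (r delta m M theta KF KC : R) :
  0 < delta -> 0 <= m -> 0 < M < 1 -> 0 <= theta < 1 -> 0 <= KF -> 0 <= KC ->
  (forall a, P a -> 0 <= phi a) ->
  (forall a i, P a -> [/\ P (child a i), m * size a <= size (child a i) &
     size (child a i) <= M * size a]) ->
  (forall a, P a -> \sum_i phi (child a i) <= theta * phi a) ->
  (forall a, P a ->
     Fc a `<=` (\bigcup_(i in [set: I]) Fc (child a i)) `|` Cc a) ->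
  (forall a, P a -> m * delta <= size a < delta ->
     coverable dist r (Fc a) (KF * phi a)) ->
  (forall a, P a -> delta <= size a -> coverable dist r (Cc a) (KC * phi a)) ->
  forall a, P a -> m * delta <= size a ->
    coverable dist r (Fc a) ((KF + KC / (1 - theta)) * phi a).
Proof.
move=> delta0 m0 M01 /andP[theta0 theta1] KF0 KC0 phi0 hchild hphi hF hbase hC.
have /andP[M0 M1] := M01.
have q0 : 0 <= KC / (1 - theta) by rewrite divr_ge0// subr_ge0 ltW.
move=> a; have [n] : exists n, size a * M ^+ n < delta.
  have [a0|a0] := leP (size a) 0.
    by exists 0%N; rewrite expr0 mulr1 (le_lt_trans a0).
  have [n hn] := @expr_lt _ M (delta / size a) M01 ltac:(by rewrite divr_gt0).
  by exists n; rewrite mulrC -ltr_pdivlMr.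
have base b : P b -> m * delta <= size b -> size b < delta ->
    coverable dist r (Fc b) ((KF + KC / (1 - theta)) * phi b).
  move=> Pb hb bd; apply: coverable_mono (hbase b Pb _) => //.
    by rewrite ler_wpM2r ?phi0// lerDl.
  by rewrite hb.
elim: n a => [|n ih] a hn Pa ma.
  by apply: base => //; rewrite expr0 mulr1 in hn.
have [ad|da] := ltP (size a) delta; first exact: base.
have hch i : coverable dist r (Fc (child a i))
    ((KF + KC / (1 - theta)) * phi (child a i)).
  have [Pc mc cM] := hchild a i Pa; apply: ih => //.
    apply: le_lt_trans hn; rewrite exprS mulrA [size a * M]mulrC.
    by rewrite ler_wpM2r// exprn_ge0// ltW.
  by apply: le_trans mc; rewrite ler_wpM2l.
apply: coverable_mono (coverableU (coverable_bigcup hch) (hC a Pa da)) => //.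
  exact: hF.
rewrite -mulr_sumr; apply: (@le_trans _ _
   ((KF + KC / (1 - theta)) * (theta * phi a) + KC * phi a)).
  by rewrite lerD2r ler_wpM2l ?hphi// addr_ge0.
rewrite mulrA -mulrDl ler_wpM2r ?phi0//.
have e : KC = (KC / (1 - theta)) * (1 - theta).
  by rewrite divfK// gt_eqF// subr_gt0.
rewrite {2}e; move: q0; set q := KC / _ => q0.
have : 0 <= KF * (1 - theta) by rewrite mulr_ge0// subr_ge0 ltW.
lra.
Qed.

(** The cylinder with parameters [u] is the image under [y |-> u.1 * y + u.2];
    its weight [(u.1 / r) `^ t] is contracted because the sum of the [a j `^ t]
    is less than one. Scales up to [m^-1] are included because the planar
    recursion at scale [r] stops at rectangles whose width may be as small as
    [m * r]. *)
Lemma selfsimilar_coverable (R : realType) (J : finType) (a tau : J -> R)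
    (E C : set R) (m M t K : R) :
  0 < m -> 0 < M < 1 -> (forall j, m <= a j <= M) -> 0 <= t -> 0 <= K ->
  \sum_j a j `^ t < 1 ->
  (forall y z, E y -> E z -> `|y - z| <= 1) ->
  E `<=` (\bigcup_(j in [set: J]) ((fun y => a j * y + tau j) @` E)) `|` C ->
  (forall r, 0 < r <= 1 -> coverable (@line_dist R) r C (K * r `^ (- t))) ->
  exists2 K', 0 < K' & forall r, 0 < r <= m^-1 ->
    coverable (@line_dist R) r E (K' * r `^ (- t)).
Proof.
move=> m0 M01 ha t0 K0 hsum diamE hE hC; have /andP[M0 M1] := M01.
have a0 j : 0 < a j by have /andP[/(lt_le_trans m0)] := ha j.
pose theta := \sum_j a j `^ t.
have theta0 : 0 <= theta by apply: sumr_ge0 => j _; exact: powR_ge0.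
exists (m `^ (- t) + K / (1 - theta)).
  by rewrite ltr_pwDl ?powR_gt0// divr_ge0// subr_ge0 ltW.
move=> r /andP[r0 rm].
pose copy (u : R * R) y := u.1 * y + u.2.
have : coverable (@line_dist R) r (copy (1, 0) @` E)
    ((m `^ (- t) + K / (1 - theta)) * (1 / r) `^ t).
  apply: (@cylinder_covering R R (@line_dist R) J (R * R)%type
    (fun u => 0 < u.1 <= 1) fst (fun u => (u.1 / r) `^ t)
    (fun u j => (u.1 * a j, u.1 * tau j + u.2))
    (fun u => copy u @` E) (fun u => copy u @` C) r r m M theta) => //=.
  - exact: ltW.
  - by rewrite theta0.
  - exact: powR_ge0.
  - by move=> u _; exact: powR_ge0.
  - move=> u j /andP[u0 u1]; have /andP[mj jM] := ha j; split.
    + rewrite mulr_gt0//= mulr_ile1// ?ltW//; exact: le_lt_trans M1.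
    + by rewrite mulrC ler_pM2l.
    + by rewrite mulrC ler_pM2r.
  - move=> u /andP[u0 u1]; rewrite /theta mulr_suml ler_sum// => j _.
    by rewrite -powRM ?(ltW (a0 _)) ?divr_ge0 ?(ltW u0) ?(ltW r0)// mulrA [a j * _]mulrC.
  - move=> u _ _ [y Ey <-]; have [[j _ [z Ez <-]]|Cy] := hE _ Ey.
      by left; exists j => //; exists z => //; rewrite /copy/=; ring.
    by right; exists y.
  - move=> u /andP[u0 u1] /andP[mu ur].
    apply: (@coverable_mono _ _ _ r _ (copy u @` E) _ 1) => //.
      rewrite powRN ler_pdivlMl ?powR_gt0// mulr1 ge0_ler_powR ?nnegrE ?divr_ge0 ?(ltW m0) ?(ltW u0) ?(ltW r0)//.
      by rewrite ler_pdivlMr.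
    apply: coverable1 => _ _ [y Ey <-] [z Ez <-]; rewrite /line_dist /copy.
    have -> : u.1 * y + u.2 - (u.1 * z + u.2) = u.1 * (y - z) by ring.
    rewrite normrM gtr0_norm//; apply: le_trans (ltW ur).
    by rewrite ler_piMr ?diamE// ltW.
  - move=> u /andP[u0 u1] ru.
    have := hC (r / u.1); rewrite divr_gt0//= ler_pdivrMr// mul1r ru => /(_ isT).
    rewrite -powR_invr ?divr_ge0 ?(ltW u0) ?(ltW r0)// invf_div.
    apply: coverable_image (ltW u0) _ _.
      move=> y z _ _; rewrite /line_dist /copy.
      have -> : u.1 * y + u.2 - (u.1 * z + u.2) = u.1 * (y - z) by ring.
      by rewrite normrM gtr0_norm.
    by rewrite mulrCA divff ?mulr1// gt_eqF.
  - by rewrite ltr01 lexx.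
  - by rewrite -ler_pdivlMl// mulr1.
rewrite div1r powR_invr ?(ltW r0)//; apply: coverable_mono => // y Ey.
by exists y => //; rewrite /copy mul1r addr0.
Qed.

(** * Covers of stretched planar sets *)

Section planar_covers.
Variable R : realType.
Implicit Types (p q s : R * R) (F C : set (R * R)) (E : set R).

Definition transpose p : R * R := (p.2, p.1).

Lemma transposeK : involutive transpose. Proof. by case. Qed.

Lemma plane_dist_transpose p q :
  plane_dist (transpose p) (transpose q) = plane_dist p q.
Proof. by rewrite /plane_dist /= addrC. Qed.

Lemma transpose_diag_map (c d : R) s p :
  transpose (diag_map c d s p) = diag_map d c (transpose s) (transpose p).
Proof. by []. Qed.

Lemma image_transposeK F : transpose @` (transpose @` F) = F.
Proof.
rewrite image_comp; under eq_imagel do rewrite /= transposeK.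
by rewrite image_id.
Qed.

Lemma fst_transpose F : fst @` (transpose @` F) = snd @` F.
Proof. by rewrite image_comp. Qed.

Lemma coverable_transpose F (r x : R) :
  coverable (@plane_dist R) r F x ->
  coverable (@plane_dist R) r (transpose @` F) x.
Proof.
apply: (@coverable_image _ _ _ _ _ _ _ 1) => //; last by rewrite mul1r.
by move=> p q _ _; rewrite plane_dist_transpose mul1r.
Qed.

(** Only the horizontal direction has to be subdivided when the image is no
    higher than [r]. *)
Lemma diag_map_coverable_fst (c d h r x : R) s F : 0 < c -> 0 <= d ->
  d * h <= r -> (forall p q, F p -> F q -> `|p.2 - q.2| <= h) ->
  coverable (@line_dist R) (r / c) (fst @` F) x ->
  coverable (@plane_dist R) (2 * r) (diag_map c d s @` F) x.
Proof.
move=> c0 d0 dhr hF [k [V [hV FV]] kx]; exists k => //.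
exists (fun j => diag_map c d s @` [set p | F p /\ V j p.1]); split.
  move=> j _ _ [p [Fp Vp] <-] [q [Fq Vq] <-]; apply: plane_dist_le => /=.
    have -> : c * p.1 + s.1 - (c * q.1 + s.1) = c * (p.1 - q.1) by ring.
    rewrite normrM gtr0_norm// mulrC -ler_pdivlMr//.
    exact: hV Vp Vq.
  have -> : d * p.2 + s.2 - (d * q.2 + s.2) = d * (p.2 - q.2) by ring.
  by rewrite normrM ger0_norm//; apply: le_trans dhr; rewrite ler_wpM2l ?hF.
move=> _ [p Fp <-]; have [|j _ Vj] := FV p.1; first by exists p.
by exists j => //; exists p.
Qed.

(** The definition of the Assouad dimension controls only small balls; on a
    bounded set the other scales cost a constant factor. *)
Lemma assouad_dim_bound E (t : R) : E `<=` `[0, 1] -> 0 <= t ->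
  (assouad_dim (@line_dist R) E < t%:E)%E ->
  exists2 K : R, 0 < K & forall x r r', E x -> 0 < r <= r' -> r' <= 1 ->
    coverable (@line_dist R) r (dist_ball (@line_dist R) x r' `&` E)
      (K * (r' / r) `^ t).
Proof.
move=> E01 t0 /ereal_inf_lt[_ [a [K0 [rho [K00 rho0 ha]]] <-]].
rewrite lte_fin => lt_at.
(* the definition applies up to the radius [r1], here capped by the diameter of
   the unit interval *)
pose r1 := Num.min rho 1; have r10 : 0 < r1 by rewrite lt_min rho0 ltr01.
have r1rho : r1 <= rho by rewrite ge_min lexx.
have r11 : r1 <= 1 by rewrite ge_min lexx orbT.
have pow_ge1 r r' : 0 < r -> r <= r' -> 1 <= (r' / r) `^ t.
  move=> r0 rr'; rewrite -(powRr0 (r' / r)); apply: ler_powR => //.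
  by rewrite ler_pdivlMr// mul1r.
have small x r r' : E x -> 0 < r -> r < r' -> r' <= r1 ->
    coverable (@line_dist R) r (dist_ball (@line_dist R) x r' `&` E)
      (K0 * (r' / r) `^ t).
  move=> Ex r0 rr' r'r1.
  have /covering_number_le : (covering_number (@line_dist R) r
      (dist_ball (@line_dist R) x r' `&` E) <= (K0 * (r' / r) `^ a)%:E)%E.
    apply: le_trans (ha r r' r0 rr' (le_trans r'r1 r1rho)).
    by apply: ereal_sup_ubound; exists x.
  apply: coverable_mono => //; rewrite ler_pM2l//; apply: ler_powR; last exact: ltW.
  by rewrite ler_pdivlMr// mul1r ltW.
have Ecov : coverable (@line_dist R) r1 E (1 / r1 + 1).
  apply: coverable_mono (@interval_coverable _ 0 1 r1 ler01 r10) => //.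
  by rewrite add0r.
pose n := 1 / r1 + 1; have n0 : 0 <= n by rewrite addr_ge0// divr_ge0// ltW.
exists (3 + K0 + n * (1 + K0)).
  by have := mulr_ge0 n0 (addr_ge0 ler01 (ltW K00)); move: K00; lra.
move=> x r r' Ex /andP[r0 rr'] r'1.
have p1 := pow_ge1 r r' r0 rr'.
have p0 : 0 <= (r' / r) `^ t by rewrite powR_ge0.
have nK : 0 <= n * K0 by rewrite mulr_ge0// ltW.
have K0p := mulr_ge0 (ltW K00) p0.
have np := mulr_ge0 n0 p0.
have nKp := mulr_ge0 nK p0.
have [<-{pow_ge1}|neq] := eqVneq r r'.
  apply: coverable_mono (@interval_coverable _ (x - r) (2 * r) r _ r0) => //.
  - move=> y [+ _]; rewrite /dist_ball/line_dist/= in_itv/= ler_norml.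
    by move=> /andP[h1 h2]; apply/andP; split; lra.
  - rewrite divff ?gt_eqF// powR1 mulfK ?gt_eqF//; nra.
  - by rewrite mulr_ge0// ltW.
have {neq}rr'' : r < r' by rewrite lt_neqAle neq.
have [r'r1|r1r'] := leP r' r1.
  by apply: coverable_mono (small _ _ _ Ex r0 rr'' r'r1) => //; nra.
have [r1r|rr1] := leP r1 r.
  apply: coverable_mono Ecov => //.
  by rewrite -/n; have := ler_peMr n0 p1; lra.
have [k [U [hU EU]] kn] := Ecov.
have piece j : coverable (@line_dist R) r (U j `&` E) (K0 * (r1 / r) `^ t).
  have [[z [Uz Ez]]|/nonemptyPn ->] := pselect (U j `&` E !=set0); last first.
    apply: coverable_mono (coverable_set0 _ r) => //.
    by rewrite mulr_ge0 ?powR_ge0// ltW.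
  apply: coverable_mono (small z r r1 Ez r0 rr1 (lexx _)) => // y [Uy Ey].
  by split=> //; exact: hU Uz Uy.
have := coverable_bigcup_ord _ piece kn.
move=> /(_ (mulr_ge0 (ltW K00) (powR_ge0 _ _))); apply: coverable_mono => //.
  by move=> y [_ Ey]; have [j _ Uj] := EU y Ey; exists j.
apply: (@le_trans _ _ (n * (K0 * (r' / r) `^ t))); last by nra.
rewrite ler_wpM2l// ler_pM2l// ge0_ler_powR ?nnegrE ?divr_ge0//.
- exact: ltW.
- exact: ltW.
- exact: le_trans (ltW r0) rr'.
- exact: ltW.
- by rewrite ler_pM2r ?invr_gt0// ltW.
Qed.

(** A cover of [C] at scale [r / d] becomes, under the affine map, a family of
    sets of height [r] and width [c * r / d]. Each is subdivided by covering
    the corresponding ball of the projection of [C] at scale [r / c]; the ratio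
    of the two scales is [c / d]. *)
Lemma stretched_coverable (C : set (R * R)) (t b K1 K2 c d r : R) s :
  0 <= K1 -> 0 <= K2 ->
  (forall r, 0 < r <= 1 -> coverable (@plane_dist R) r C (K1 * r `^ (- b))) ->
  (forall x r r', (fst @` C) x -> 0 < r <= r' -> r' <= 1 ->
    coverable (@line_dist R) r (dist_ball (@line_dist R) x r' `&` (fst @` C))
      (K2 * (r' / r) `^ t)) ->
  0 < r <= d -> d <= c -> c <= 1 ->
  coverable (@plane_dist R) (2 * r) (diag_map c d s @` C)
    (K1 * K2 * r `^ (- b) * (c `^ t * d `^ (b - t))).
Proof.
move=> K10 K20 hC hA /andP[r0 rd] dc c1.
have d0 := lt_le_trans r0 rd; have c0 := lt_le_trans d0 dc.
have [|k [U [hU CU]] kK] := hC (r / d).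
  by rewrite divr_gt0//= ler_pdivrMr// mul1r.
have piece j : coverable (@plane_dist R) (2 * r)
    (diag_map c d s @` (U j `&` C)) (K2 * (c / d) `^ t).
  have [[z [Uz Cz]]|/nonemptyPn ->] := pselect (U j `&` C !=set0); last first.
    rewrite image_set0; apply: coverable_mono (coverable_set0 _ _) => //.
    by rewrite mulr_ge0 ?powR_ge0.
  apply: (@diag_map_coverable_fst c d (r / d)) => //.
  - exact: ltW.
  - by rewrite mulrCA divff ?mulr1// gt_eqF.
  - by move=> p q [Up _] [Uq _]; apply: le_trans (plane_dist_snd p q) (hU j _ _ Up Uq).
  have -> : c / d = (r / d) / (r / c).
    by field; rewrite !gt_eqF.
  have h1 : 0 < r / c <= r / d by rewrite divr_gt0//= ler_pM2l// lef_pV2.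
  have h2 : r / d <= 1 by rewrite ler_pdivrMr// mul1r.
  have Cz1 : (fst @` C) z.1 by exists z.
  apply: coverable_mono (hA _ _ _ Cz1 h1 h2) => // _ [p [Up Cp] <-].
  split; last by exists p.
  exact: le_trans (plane_dist_fst z p) (hU j _ _ Uz Up).
have := coverable_bigcup_ord _ piece kK.
move=> /(_ (mulr_ge0 K20 (powR_ge0 _ _))); apply: coverable_mono => //.
  by move=> _ [p Cp <-]; have [j _ Uj] := CU p Cp; exists j => //; exists p.
rewrite le_eqVlt; apply/orP; left; apply/eqP.
rewrite -[r / d]invf_div powR_invr ?divr_ge0 ?(ltW d0) ?(ltW r0)// opprK.
rewrite !powRM ?invr_ge0 ?(ltW d0) ?(ltW r0) ?(ltW c0)//.
rewrite !powR_invr ?(ltW d0) ?(ltW r0)// [d `^ (b - t)]powRDp//.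
by ring.
Qed.

End planar_covers.
Arguments transpose {R}.

(** * Upper bound for planar self-affine sets *)

(** The factor [m `^ (- `|t - b|)] accounts for the replacement of [r] by the
    comparable height [d]. *)
Lemma thin_coverable (R : realType) (F : set (R * R)) (m t b K c d r : R)
    (s : R * R) :
  0 < m -> 0 <= K -> (forall p q, F p -> F q -> `|p.2 - q.2| <= 1) ->
  (forall r, 0 < r <= m^-1 ->
    coverable (@line_dist R) r (fst @` F) (K * r `^ (- t))) ->
  0 < r -> d <= c -> m * r <= d <= r ->
  coverable (@plane_dist R) (2 * r) (diag_map c d s @` F)
    (K * m `^ (- `|t - b|) * r `^ (- b) * (c `^ t * d `^ (b - t))).
Proof.
move=> m0 K0 F1 hF r0 dc /andP[mrd dr].
have d0 : 0 < d by apply: lt_le_trans mrd; rewrite mulr_gt0.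
have c0 := lt_le_trans d0 dc.
apply: (@diag_map_coverable_fst _ c d 1) => //; first exact: ltW.
  by rewrite mulr1.
have hrc : 0 < r / c <= m^-1.
  rewrite divr_gt0//= ler_pdivrMr// mulrC ler_pdivlMr// mulrC.
  exact: le_trans mrd dc.
apply: coverable_mono (hF _ hrc) => //.
rewrite -!mulrA ler_wpM2l//.
rewrite -[r / c]invf_div powR_invr ?divr_ge0 ?(ltW c0) ?(ltW r0)// opprK.
rewrite powRM ?invr_ge0 ?(ltW c0) ?(ltW r0)// powR_invr ?(ltW r0)//.
have -> : r `^ (- t) = r `^ (- b) * d `^ (b - t) * (d / r) `^ (t - b).
  rewrite powRM ?invr_ge0 ?(ltW d0) ?(ltW r0)// powR_invr ?(ltW r0)// opprB.
  transitivity (r `^ (- b) * r `^ (b - t) * (d `^ (b - t) * d `^ (t - b))).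
    rewrite -!powRDp// (_ : b - t + (t - b) = 0) ?powRr0 ?mulr1; last by ring.
    by congr powR; ring.
  by ring.
have hd : m <= d / r <= 1 by rewrite ler_pdivlMr// mrd ler_pdivrMr// mul1r.
have := powR_le_abs (t - b) m0 hd.
move=> /(ler_wpM2l (mulr_ge0 (mulr_ge0 (powR_ge0 c t) (powR_ge0 r (- b)))
  (powR_ge0 d (b - t)))).
lra.
Qed.

Lemma coverable_diag_transpose (R : realType) (F : set (R * R)) (c d r x : R)
    (s : R * R) :
  coverable (@plane_dist R) r
    (diag_map d c (transpose s) @` (transpose @` F)) x ->
  coverable (@plane_dist R) r (diag_map c d s @` F) x.
Proof.
move=> /coverable_transpose; rewrite image_comp; apply: coverable_mono => //.
move=> _ [p Fp <-]; exists (transpose p); first by exists p.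
by rewrite /= transpose_diag_map !transposeK.
Qed.

(** The predicate [P] is an invariant of the side lengths of cylinders, such as
    being at least as wide as high, and [phi] is the weight contracted by the
    recursion. *)
Lemma carpet_upper_box_dim (R : realType) (I : finType) (c d : I -> R)
    (t : I -> R * R) (F C : set (R * R)) (m M b theta KF KC : R)
    (P : R -> R -> Prop) (phi : R -> R -> R) :
  0 < m -> 0 < M < 1 -> 0 <= theta < 1 -> 0 <= KF -> 0 <= KC ->
  (forall i, m <= c i <= M /\ m <= d i <= M) ->
  P 1 1 -> (forall x y i, P x y -> P (x * c i) (y * d i)) ->
  (forall x y, 0 <= phi x y) ->
  (forall x y, 0 < x -> 0 < y ->
     \sum_i phi (x * c i) (y * d i) <= theta * phi x y) ->
  F `<=` (\bigcup_(i in [set: I]) (diag_map (c i) (d i) (t i) @` F)) `|` C ->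
  (forall x y r s, P x y -> 0 < r -> x <= 1 -> y <= 1 ->
     m * r <= Num.min x y < r ->
     coverable (@plane_dist R) (2 * r) (diag_map x y s @` F)
       (KF * r `^ (- b) * phi x y)) ->
  (forall x y r s, P x y -> 0 < r -> x <= 1 -> y <= 1 -> r <= Num.min x y ->
     coverable (@plane_dist R) (2 * r) (diag_map x y s @` C)
       (KC * r `^ (- b) * phi x y)) ->
  (upper_box_dim (@plane_dist R) F <= b%:E)%E.
Proof.
move=> m0 M01 th KF0 KC0 hcd P1 Pcd phi0 hphi hF hbase hC.
have /andP[th0 th1] := th; have /andP[M0 M1] := M01.
have /= c0 i : 0 < c i by have [/andP[/(lt_le_trans m0)]] := hcd i.
have /= d0 i : 0 < d i by have [_ /andP[/(lt_le_trans m0)]] := hcd i.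
have cover r : 0 < r -> m * r <= 1 -> coverable (@plane_dist R) (2 * r) F
    ((KF + KC / (1 - theta)) * phi 1 1 * r `^ (- b)).
  move=> r0 mr.
  have : coverable (@plane_dist R) (2 * r) (diag_map 1 1 (0, 0) @` F)
      ((KF * r `^ (- b) + KC * r `^ (- b) / (1 - theta)) * phi 1 1).
    apply: (@cylinder_covering R _ (@plane_dist R) I (R * R * (R * R))%type
      (fun a => [/\ P a.1.1 a.1.2, 0 < a.1.1 <= 1 & 0 < a.1.2 <= 1])
      (fun a => Num.min a.1.1 a.1.2) (fun a => phi a.1.1 a.1.2)
      (fun a i => ((a.1.1 * c i, a.1.2 * d i),
         (a.1.1 * (t i).1 + a.2.1, a.1.2 * (t i).2 + a.2.2)))
      (fun a => diag_map a.1.1 a.1.2 a.2 @` F)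
      (fun a => diag_map a.1.1 a.1.2 a.2 @` C)
      (2 * r) r m M theta _ _ _ _ _ _ _ _ _ _ _ _ _ _ ((1, 1), (0, 0)));
      rewrite ?mulr_ge0 ?powR_ge0//= ?ltr01 ?lexx ?minxx//.
    - exact: ltW.
    - move=> [[x y] s] i [/= Pxy /andP[x0 x1] /andP[y0 y1]].
      have [/andP[mc cM] /andP[md dM]] := hcd i.
      split.
      + split; first exact: Pcd.
        * by rewrite mulr_gt0//= mulr_ile1// ?(ltW x0) ?(ltW (c0 i))// (le_trans cM)// ltW.
        * by rewrite mulr_gt0//= mulr_ile1// ?(ltW y0) ?(ltW (d0 i))// (le_trans dM)// ltW.
      + rewrite le_min; apply/andP; split.
        * by rewrite mulrC ler_pM ?(ltW m0)// ?le_min ?(ltW x0) ?(ltW y0)// ge_min lexx.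
        * by rewrite mulrC ler_pM ?(ltW m0)// ?le_min ?(ltW x0) ?(ltW y0)// ge_min lexx orbT.
      + rewrite minr_pMr ?(ltW M0)// le_min !ge_min; apply/andP; split.
        * by rewrite mulrC ler_wpM2r// ltW.
        * by rewrite [y * d i]mulrC ler_wpM2r ?orbT// ltW.
    - by move=> [[x y] s] [/= Pxy /andP[x0 _] /andP[y0 _]]; exact: hphi.
    - move=> [[x y] s] _ _ [p Fp <-]; have [[i _ [q Fq <-]]|Cp] := hF _ Fp.
        left; exists i => //; exists q => //=; rewrite /diag_map/=.
        by congr pair; ring.
      by right; exists p.
    - by move=> [[x y] s] [/= Pxy /andP[_ x1] /andP[_ y1]] h; apply: hbase.
    - by move=> [[x y] s] [/= Pxy /andP[_ x1] /andP[_ y1]] h; apply: hC.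
  apply: coverable_mono => //.
    by move=> p Fp; exists p => //; rewrite /diag_map/= !mul1r !addr0 -surjective_pairing.
  by rewrite le_eqVlt; apply/orP; left; apply/eqP; ring.
pose K := (KF + KC / (1 - theta)) * phi 1 1.
have K0 : 0 <= K.
  by rewrite mulr_ge0// addr_ge0// divr_ge0// subr_ge0 ltW.
apply: (@upper_box_dim_le _ _ _ _ ((K + 1) * 2 `^ b) (2 / m)).
- by rewrite mulr_gt0 ?powR_gt0// ltr_wpDl.
- by rewrite divr_gt0.
move=> r /andP[r0 rm]; have := cover (r / 2).
have mr : m * (r / 2) <= 1.
  by rewrite mulrA ler_pdivrMr// mul1r mulrC -ler_pdivlMr// ltW.
rewrite divr_gt0// => /(_ isT mr); apply: coverable_mono => //.
  by rewrite mulrC divfK.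
rewrite -/K powRM ?invr_ge0 ?(ltW r0)// powR_invr// opprK.
have := mulr_ge0 (powR_ge0 2 b) (powR_ge0 r (- b)); lra.
Qed.

(** * Separated rectangles indexed by words *)

(** The intervals [[x, x + c]] and [[x', x' + c']] have disjoint interiors. *)
Definition apart (R : realType) (c x c' x' : R) : Prop :=
  x + c <= x' \/ x' + c' <= x.

(** Stability is common to the homogeneous and the inhomogeneous attractors and
    to the sets [E * {0}] with [E] stable on the line, all of which serve as
    [E] below. *)
Record carpet_system (R : realType) (J : finType) (c d : J -> R)
    (t : J -> R * R) (E : set (R * R)) : Prop := CarpetSystem {
  carpet_hscale : forall j, 0 < c j <= 1;
  carpet_vscale : forall j, 0 < d j <= 1;
  carpet_square : forall j, [/\ 0 <= (t j).1, (t j).1 + c j <= 1,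
    0 <= (t j).2 & (t j).2 + d j <= 1];
  carpet_apart : forall i j, i != j ->
    apart (c i) (t i).1 (c j) (t j).1 \/ apart (d i) (t i).2 (d j) (t j).2;
  carpet_stable : forall j, diag_map (c j) (d j) (t j) @` E `<=` E
}.

Lemma carpet_system_transpose (R : realType) (J : finType) (c d : J -> R)
    (t : J -> R * R) (E : set (R * R)) : carpet_system c d t E ->
  carpet_system d c (fun j => transpose (t j)) (transpose @` E).
Proof.
move=> [hc hd hsq hap hst]; split=> //.
- by move=> j; have [] := hsq j.
- by move=> i j /hap [] ?; [right|left].
move=> j _ [_ [p Ep <-] <-]; exists (diag_map (c j) (d j) (t j) p) => //.
by apply: hst; exists p.
Qed.

Lemma carpet_system_reindex (R : realType) (J J' : finType) (g : J' -> J)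
    (c d : J -> R) (t : J -> R * R) (E : set (R * R)) :
  injective g -> carpet_system c d t E ->
  carpet_system (c \o g) (d \o g) (t \o g) E.
Proof.
move=> ginj [hc hd hsq hap hst]; split=> //= i j ij; apply: hap.
by apply: contraNneq ij => /ginj ->.
Qed.

Section words.
Variables (R : realType) (J : finType).
Implicit Types (c x : J -> R) (w : seq J).

Definition word_scale c w : R := \prod_(j <- w) c j.

(** One coordinate of the translation part of the map coded by a word. *)
Fixpoint word_shift c x w : R :=
  if w is j :: w' then c j * word_shift c x w' + x j else 0.

Lemma word_scale_gt0 c w : (forall j, 0 < c j) -> 0 < word_scale c w.
Proof. by move=> c0; apply: prodr_gt0. Qed.

Lemma word_scale_le1 c w : (forall j, 0 < c j <= 1) -> word_scale c w <= 1.
Proof.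
by move=> hc; apply: prodr_ile1 => j; have /andP[/ltW -> ->] := hc j.
Qed.

Lemma word_shift_square c x w : (forall j, 0 < c j) -> (forall j, 0 <= x j) ->
  (forall j, x j + c j <= 1) ->
  0 <= word_shift c x w /\ word_shift c x w + word_scale c w <= 1.
Proof.
move=> c0 x0 xc; elim: w => [|j w [ih1 ih2]]; rewrite /word_scale.
  by rewrite big_nil/= add0r.
rewrite big_cons/=; split; first by rewrite addr_ge0// mulr_ge0// ltW.
have := ler_wpM2l (ltW (c0 j)) ih2; have := xc j; rewrite /word_scale; lra.
Qed.

(** At the first letter where the words differ the two rectangles are separated
    in one direction, and the common prefix acts on both by the same affine
    map. *)
Lemma word_apart c d t E w w' : carpet_system c d t E -> size w = size w' ->
  w != w' ->
  apart (word_scale c w) (word_shift c (fst \o t) w)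
        (word_scale c w') (word_shift c (fst \o t) w') \/
  apart (word_scale d w) (word_shift d (snd \o t) w)
        (word_scale d w') (word_shift d (snd \o t) w').
Proof.
move=> [hc hd hsq hap hst].
have c0 j : 0 < c j by have /andP[] := hc j.
have d0 j : 0 < d j by have /andP[] := hd j.
have sqc v : 0 <= word_shift c (fst \o t) v /\
    word_shift c (fst \o t) v + word_scale c v <= 1.
  by apply: word_shift_square => //= j; have [] := hsq j.
have sqd v : 0 <= word_shift d (snd \o t) v /\
    word_shift d (snd \o t) v + word_scale d v <= 1.
  by apply: word_shift_square => //= j; have [] := hsq j.
elim: w w' => [|j w ih] [|j' w'] //= [ss]; rewrite /word_scale !big_cons.
rewrite -!/(word_scale _ _).
have [{j'}<-|jj'] := eqVneq j j'.
  rewrite eqseq_cons eqxx/= => /(ih _ ss)[|] [] h; [left; left|left; right|right; left|right; right].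
  - by have := ler_wpM2l (ltW (c0 j)) h; lra.
  - by have := ler_wpM2l (ltW (c0 j)) h; lra.
  - by have := ler_wpM2l (ltW (d0 j)) h; lra.
  - by have := ler_wpM2l (ltW (d0 j)) h; lra.
move=> _.
have [a1 a2] := sqc w; have [b1 b2] := sqc w'.
have [a3 a4] := sqd w; have [b3 b4] := sqd w'.
have /= ka1 := mulr_ge0 (ltW (c0 j)) a1; have /= kb1 := mulr_ge0 (ltW (c0 j')) b1.
have /= ka3 := mulr_ge0 (ltW (d0 j)) a3; have /= kb3 := mulr_ge0 (ltW (d0 j')) b3.
have := ler_wpM2l (ltW (c0 j)) a2; have := ler_wpM2l (ltW (c0 j')) b2.
have := ler_wpM2l (ltW (d0 j)) a4; have := ler_wpM2l (ltW (d0 j')) b4.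
have [[]|[]] := hap _ _ jj' => h ????; [left; left|left; right|right; left|right; right];
  rewrite /=; lra.
Qed.

Lemma carpet_system_words c d t E n : carpet_system c d t E ->
  carpet_system (fun w : n.-tuple J => word_scale c w)
    (fun w : n.-tuple J => word_scale d w) (fun w : n.-tuple J => (word_shift c (fst \o t) w, word_shift d (snd \o t) w)) E.
Proof.
move=> hS; have [hc hd hsq hap hst] := hS.
have c0 j : 0 < c j by have /andP[] := hc j.
have d0 j : 0 < d j by have /andP[] := hd j.
split.
- by move=> w; rewrite word_scale_gt0//= word_scale_le1.
- by move=> w; rewrite word_scale_gt0//= word_scale_le1.
- move=> w /=.
  have x0 j : 0 <= (t j).1 by have [] := hsq j.
  have x1 j : (t j).1 + c j <= 1 by have [] := hsq j.
  have y0 j : 0 <= (t j).2 by have [] := hsq j.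
  have y1 j : (t j).2 + d j <= 1 by have [] := hsq j.
  have [? ?] := @word_shift_square c (fst \o t) w c0 x0 x1.
  by have [? ?] := @word_shift_square d (snd \o t) w d0 y0 y1.
- by move=> w w' ww'; apply: (word_apart hS) => //; rewrite !size_tuple.
- move=> w /=; elim: (tval w) => {w} [|j w ih] _ [p Ep <-].
    by rewrite /word_scale !big_nil /diag_map/= !mul1r !addr0 -surjective_pairing.
  apply: (hst j); exists (diag_map (word_scale c w) (word_scale d w)
      (word_shift c (fst \o t) w, word_shift d (snd \o t) w) p).
    by apply: ih; exists p.
  by rewrite /word_scale !big_cons /diag_map/=; congr pair; ring.
Qed.

End words.

Section packing.
Variables (R : realType) (J : finType) (c d : R) (t : J -> R * R).
Variable E : set (R * R).
Hypothesis dc : d <= c.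
Hypothesis E01 : E `<=` @unit_square R.
Hypothesis hS : carpet_system (fun=> c) (fun=> d) t E.

Let img j p := diag_map c d (t j) p.

(** Inside each rectangle met by [U] there is a square of side [d] within
    distance [d] of a point of [U]. These squares have disjoint interiors and
    lie in a square of side [4 * d], so the cells of a grid of mesh [d]
    separate them. *)
Lemma rectangles_met (U : set (R * R)) (A : {set J}) :
  (forall p q, U p -> U q -> plane_dist p q <= d) ->
  (forall j, j \in A -> exists2 p, E p & U (img j p)) -> (#|A| <= 16)%N.
Proof.
move=> dU hA.
have [->|[j0 j0A]] := set_0Vmem A; first by rewrite cards0.
have [p0 Ep0 Up0] := hA _ j0A.
have d0 : 0 < d by have /andP[] := carpet_vscale hS j0.
have c0 := lt_le_trans d0 dc.
have [y hy] : {y : J -> R * R & forall j, j \in A -> E (y j) /\ U (img j (y j))}.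
  apply: (@choice _ _ (fun j y => j \in A -> E y /\ U (img j y))) => j.
  have [jA|] := boolP (j \in A); last by exists p0.
  by have [p Ep Up] := hA j jA; exists p.
set u := img j0 p0 in Up0.
(* [q1 j] is the left end of a square of side [d] that lies in the rectangle and
   reaches the point of [U] or the right edge *)
pose q1 j := Num.min (img j (y j)).1 ((t j).1 + c - d).
pose v1 j := (q1 j - (u.1 - 2 * d)) / d.
pose v2 j := ((t j).2 - (u.2 - 2 * d)) / d.
have v1d j : v1 j * d = q1 j - (u.1 - 2 * d).
  by rewrite divfK// gt_eqF.
have v2d j : v2 j * d = (t j).2 - (u.2 - 2 * d) by rewrite divfK// gt_eqF.
have pos j : j \in A -> [/\ (t j).1 <= (img j (y j)).1, (img j (y j)).1 <= (t j).1 + c,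
    (t j).2 <= (img j (y j)).2 & (img j (y j)).2 <= (t j).2 + d].
  move=> jA; have [Ey _] := hy j jA.
  have [/=] := E01 Ey; rewrite !in_itv/= => /andP[y10 y11] /andP[y20 y21].
  rewrite /img /=.
  have := ler_wpM2l (ltW c0) y11; have := ler_wpM2l (ltW d0) y21.
  have := mulr_ge0 (ltW c0) y10; have := mulr_ge0 (ltW d0) y20.
  by clear => *; split; lra.
have near j : j \in A -> `|(img j (y j)).1 - u.1| <= d /\ `|(img j (y j)).2 - u.2| <= d.
  move=> jA; have [_ Uy] := hy j jA; split.
    by apply: le_trans (dU _ _ Uy Up0); exact: plane_dist_fst.
  by apply: le_trans (dU _ _ Uy Up0); exact: plane_dist_snd.
have q1b j : j \in A -> (t j).1 <= q1 j /\ q1 j + d <= (t j).1 + c.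
  move=> /pos[h1 h2 _ _]; rewrite le_min h1 /= -addrA lerDl subr_ge0; split=> //.
  by rewrite -lerBrDr ge_min lexx orbT.
have v1b j : j \in A -> 0 <= v1 j <= 3.
  move=> jA; have [h1 h2 h3 h4] := pos j jA; have [] := near j jA.
  rewrite !ler_norml => /andP[n1 n2] _.
  rewrite -(ler_pM2r d0) -[v1 j <= _](ler_pM2r d0) v1d mul0r.
  rewrite /q1; case: (leP (img j (y j)).1); move: d0 h1 h2 n1 n2; clear => *; apply/andP; split; lra.
have v2b j : j \in A -> 0 <= v2 j <= 3.
  move=> jA; have [h1 h2 h3 h4] := pos j jA; have [] := near j jA.
  rewrite !ler_norml => _ /andP[n1 n2].
  rewrite -(ler_pM2r d0) -[v2 j <= _](ler_pM2r d0) v2d mul0r.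
  by apply/andP; split; lra.
(* [v1 j] and [v2 j] are the coordinates of that square in units of [d], measured
   from a corner common to all [j]; they lie in [[0, 3]] *)
pose lab (v : R) : 'I_4 := inord (Num.truncn v).
have lab_eq v v' : 0 <= v <= 3 -> 0 <= v' <= 3 -> lab v = lab v' ->
    v < v' + 1 /\ v' < v + 1.
  move=> /andP[va vb] /andP[va' vb'] /(congr1 val).
  have tr z : 0 <= z -> z <= 3 -> (Num.truncn z < 4)%N.
    by move=> z0 z3; rewrite truncn_lt_nat//; apply: le_lt_trans z3 _; rewrite ltr_nat.
  rewrite /= !inordK ?tr// => e.
  have := truncn_itv va; have := truncn_itv va'; rewrite e -natr1.
  by move=> /andP[? ?] /andP[? ?]; split; lra.
have -> : 16%N = #|{: 'I_4 * 'I_4}| by rewrite card_prod !card_ord.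
apply: (@leq_card_in _ _ (fun j => (lab (v1 j), lab (v2 j)))) => i j iA jA [].
move=> /(lab_eq _ _ (v1b _ iA) (v1b _ jA))[a1 a2].
move=> /(lab_eq _ _ (v2b _ iA) (v2b _ jA))[b1 b2].
apply/eqP; apply: contraT => ij.
have scale v v' : v < v' + 1 -> v * d < v' * d + d.
  by rewrite -[v < _](ltr_pM2r d0) mulrDl mul1r.
move: (scale _ _ a1) (scale _ _ a2) (scale _ _ b1) (scale _ _ b2).
rewrite !v1d !v2d.
have [h1 h2] := q1b i iA; have [k1 k2] := q1b j jA.
by have [[]|[]] := carpet_apart hS ij; move: h1 h2 k1 k2; clear => *; lra.
Qed.

(** Double counting of the pairs formed by a rectangle and a member of the
    cover that meets its copy of [E]. *)
Lemma packing x : cover_needs (@line_dist R) (d / c) (fst @` E) x ->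
  cover_needs (@plane_dist R) d E (#|J|%:R * x / 16).
Proof.
move=> hx k [U [hU EU]].
have [J0|[j0 _]] := set_0Vmem [set: J].
  by rewrite -cardsT J0 cards0 !mul0r.
have c0 : 0 < c by have /andP[] := carpet_hscale hS j0.
pose a j i := `[< exists2 p, E p & U i (img j p) >].
have h1 j : x <= (\sum_(i < k | a j i) 1)%N%:R.
  rewrite sum1_card; apply: hx.
  pose V (b : 'I_#|a j|) := [set y | exists p, [/\ E p, p.1 = y & U (enum_val b) (img j p)]].
  exists V; split.
    move=> b _ _ [p [Ep <- Up]] [q [Eq <- Uq]]; rewrite ler_pdivlMr// mulrC.
    apply: le_trans (hU _ _ _ Up Uq); apply: le_trans (plane_dist_fst _ _).
    rewrite /line_dist /img /=.
    have -> : c * p.1 + (t j).1 - (c * q.1 + (t j).1) = c * (p.1 - q.1) by ring.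
    by rewrite normrM gtr0_norm.
  move=> _ [p Ep <-].
  have [i _ Ui] : (\bigcup_(i in [set: 'I_k]) U i) (img j p).
    by apply: EU; apply: (carpet_stable hS (j := j)); exists p.
  have ai : i \in a j by apply/asboolP; exists p.
  by exists (enum_rank_in ai i) => //; exists p; split => //; rewrite enum_rankK_in.
have h2 i : (\sum_(j | a j i) 1 <= 16)%N.
  rewrite sum1_card -(cardsE (a^~ i)).
  apply: (@rectangles_met (U i)) => [p q|j]; first exact: hU.
  by rewrite inE => /asboolP.
rewrite ler_pdivrMr//.
apply: (@le_trans _ _ (\sum_(j : J) (\sum_(i < k | a j i) 1)%N%:R)).
  rewrite mulr_natl -sumr_const; apply: ler_sum => j _; exact: h1.
rewrite -natr_sum -natrM ler_nat.
rewrite (exchange_big_dep predT)//=.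
apply: (@leq_trans (\sum_(i < k) 16)); first by apply: leq_sum => i _; exact: h2.
by rewrite sum_nat_const card_ord.
Qed.

End packing.

(** * Permutation classes of words *)

Lemma bernoulli_ineq (R : realType) (e : R) n : 0 <= e ->
  1 + n%:R * e <= (1 + e) ^+ n.
Proof.
move=> e0; elim: n => [|n ih]; first by rewrite mul0r addr0 expr0.
rewrite exprS; apply: le_trans (ler_wpM2l (addr_ge0 ler01 e0) ih).
have := mulr_ge0 (ler0n R n) (mulr_ge0 e0 e0); rewrite -natr1; lra.
Qed.

(** Writing [rho] as the [m]-th power of [(1 + e) ^+ 2] reduces the claim to
    the domination of a linear function by a square, by the Bernoulli
    inequality. *)
Lemma polynomial_lt_exponential (R : realType) (rho : R) m : 1 < rho ->
  exists n, n.+2%:R ^+ m < rho ^+ n.+1.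
Proof.
move=> rho1; have rho0 : 0 < rho by apply: lt_trans rho1.
have [->|m0] := posnP m; first by exists 0%N; rewrite expr0 expr1.
pose e := rho `^ (2 * m%:R)^-1 - 1.
have m2 : 0 < 2 * m%:R :> R by rewrite mulr_gt0// ltr0n.
have e0 : 0 < e.
  rewrite subr_gt0 -[ltLHS](congr1 (fun f => f (2 * m%:R)^-1) (powR1 R)).
  by rewrite gt0_ltr_powR ?nnegrE ?invr_gt0// ltW.
have erho : rho = ((1 + e) ^+ 2) ^+ m.
  rewrite addrC subrK -exprM -powR_mulrn ?powR_ge0// -powRrM natrM.
  by rewrite mulVf ?gt_eqF// powRr1// ltW.
pose n := Num.truncn (e ^- 2).
have hn : 1 <= n.+1%:R * e ^+ 2.
  rewrite -ler_pdivrMr ?exprn_gt0// div1r ltW//.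
  have h : 0 <= e ^- 2 by rewrite invr_ge0 exprn_ge0// ltW.
  by case/andP: (truncn_itv h).
have e1 : 0 <= 1 + e by rewrite addr_ge0// ltW.
have ne0 : 0 < n.+1%:R * e by rewrite mulr_gt0 ?ltr0n.
exists n; rewrite {1}erho exprAC [((1 + e) ^+ 2) ^+ _]exprAC ltr_pXn2r//;
  rewrite ?nnegrE ?ler0n// ?exprn_ge0//.
apply: (@lt_le_trans _ _ ((1 + n.+1%:R * e) ^+ 2)).
  have : n.+1%:R <= n.+1%:R * (n.+1%:R * e ^+ 2) :> R by rewrite ler_peMr.
  by rewrite -[n.+2%:R]natr1; move: ne0; lra.
apply: lerXn2r; rewrite ?nnegrE ?exprn_ge0//; last by rewrite bernoulli_ineq// ltW.
by rewrite addr_ge0// ltW.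
Qed.

Lemma sum_words (R : realType) (J : finType) (p : J -> R) n :
  \sum_(w : n.-tuple J) word_scale p w = (\sum_j p j) ^+ n.
Proof.
have -> : (\sum_j p j) ^+ n = \prod_(i < n) \sum_j p j.
  by rewrite prodr_const card_ord.
rewrite bigA_distr_bigA/=.
rewrite (reindex (fun f : {ffun 'I_n -> J} => [tuple f i | i < n]))/=; last first.
  apply: onW_bij; exists (fun w : n.-tuple J => [ffun i => tnth w i]) => [f|w].
    by apply/ffunP => i; rewrite ffunE tnth_mktuple.
  by apply: eq_from_tnth => i; rewrite tnth_mktuple ffunE.
by apply: eq_bigr => f _; rewrite /word_scale/= big_map big_enum.
Qed.

(** There are only polynomially many classes of words of length [n] up to
    permutation, while the total weight grows exponentially. *)
Lemma heavy_permutation_class (R : realType) (J : finType) (p : J -> R) :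
  (forall j, 0 < p j) -> 1 < \sum_j p j ->
  exists n (w0 : n.+1.-tuple J),
    1 <= #|[pred w : n.+1.-tuple J | perm_eq w0 w]|%:R * word_scale p w0.
Proof.
move=> p0 p1; have [n hn] := polynomial_lt_exponential #|J| p1.
exists n; apply: contrapT => hw.
have {}hw (w0 : n.+1.-tuple J) :
    #|[pred w : n.+1.-tuple J | perm_eq w0 w]|%:R * word_scale p w0 < 1.
  by rewrite ltNge; apply/negP => h; apply: hw; exists w0.
(* the numbers of occurrences of the letters identify the permutation class *)
pose ty (w : n.+1.-tuple J) : {ffun J -> 'I_n.+2} :=
  [ffun j => inord (count_mem j w)].
have tyP w w' : (ty w == ty w') = perm_eq w w'.
  have cnt (v : n.+1.-tuple J) j : (count_mem j v < n.+2)%N.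
    by rewrite ltnS -[X in (_ <= X)%N](size_tuple v) count_size.
  apply/eqP/idP => [e|/permP e].
    apply/allP => j _ /=; move/ffunP/(_ j): e; rewrite !ffunE.
    by move/(congr1 val); rewrite /= !inordK// => ->.
  by apply/ffunP => j; rewrite !ffunE e.
move: hn; apply/negP; rewrite -leNgt -sum_words.
rewrite (partition_big ty predT)//=.
apply: (@le_trans _ _ (\sum_(f : {ffun J -> 'I_n.+2}) 1)).
  apply: ler_sum => f _.
  have [w0 /eqP <-|nof] := pickP (fun w => ty w == f); last by rewrite big_pred0.
  under eq_bigl do rewrite eq_sym tyP.
  apply: ltW; apply: le_lt_trans (hw w0).
  rewrite mulr_natl -sumr_const.
  by apply: ler_sum => w ww0; rewrite /word_scale (perm_big _ ww0).
by rewrite sumr_const card_ffun card_ord natrX.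
Qed.

(** * Dimension bounds from congruent rectangles *)

Lemma powR_expr (R : realType) (a x : R) k : 0 <= a ->
  (a ^+ k) `^ x = (a `^ x) ^+ k.
Proof. by move=> a0; rewrite -(powR_mulrn k a0) powRAC powR_mulrn ?powR_ge0. Qed.

Lemma word_scale_powR (R : realType) (J : finType) (c d : J -> R) (x y : R)
    (w : seq J) : (forall j, 0 < c j) -> (forall j, 0 < d j) ->
  word_scale (fun j => c j `^ x * d j `^ y) w =
  word_scale c w `^ x * word_scale d w `^ y.
Proof.
move=> c0 d0; elim: w => [|j w ih].
  by rewrite /word_scale !big_nil !powR1 mulr1.
have cw0 := word_scale_gt0 w c0; have dw0 := word_scale_gt0 w d0.
rewrite /word_scale !big_cons -!/(word_scale _ _) ih.
by rewrite !powRM ?(ltW (c0 _)) ?(ltW (d0 _)) ?(ltW cw0) ?(ltW dw0)// mulrACA.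
Qed.

Lemma word_scale_lt1 (R : realType) (J : finType) (c : J -> R) n
    (w : n.+1.-tuple J) : (forall j, 0 < c j < 1) -> word_scale c w < 1.
Proof.
move=> hc; case/tupleP: w => j w; rewrite /word_scale/= big_cons.
have /andP[c0 c1] := hc j; apply: le_lt_trans c1; rewrite ler_piMr ?(ltW c0)//.
by apply: word_scale_le1 => i; have /andP[-> /ltW ->] := hc i.
Qed.

(** All the rectangles of a permutation class of words are congruent, and a heavy
    class keeps a pressure that exceeds one. When all the rectangles of the given
    system have the same orientation, so do those of the class. *)
Lemma homogeneous_subsystem (R : realType) (J : finType) (c d : J -> R)
    (t : J -> R * R) (E : set (R * R)) (x y : R) :
  carpet_system c d t E -> (forall j, c j < 1) -> (forall j, d j < 1) ->
  1 < \sum_j c j `^ x * d j `^ y ->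
  exists (J' : finType) (c' d' : R) (t' : J' -> R * R),
    [/\ carpet_system (fun=> c') (fun=> d') t' E, 0 < c' < 1 /\ 0 < d' < 1,
        1 <= #|J'|%:R * (c' `^ x * d' `^ y),
        (forall j, d j <= c j) -> d' <= c' &
        (forall j, c j <= d j) -> c' <= d'].
Proof.
move=> hS c1 d1 hsum.
have c0 j : 0 < c j by have /andP[] := carpet_hscale hS j.
have d0 j : 0 < d j by have /andP[] := carpet_vscale hS j.
have p0 j : 0 < c j `^ x * d j `^ y by rewrite mulr_gt0 ?powR_gt0.
have [n [w0 hw0]] := heavy_permutation_class p0 hsum.
pose J' := {w : n.+1.-tuple J | perm_eq w0 w}.
have hW := carpet_system_reindex (@val_inj _ _ J') (carpet_system_words n.+1 hS).
pose tw (w : J') := (word_shift c (fst \o t) (val w), word_shift d (snd \o t) (val w)).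
have cst (f : J -> R) : (fun w : J' => word_scale f (val w)) = fun=> word_scale f w0.
  by apply/funext => -[w ww0]; rewrite /word_scale/= -(perm_big _ ww0).
exists J', (word_scale c w0), (word_scale d w0), tw; split.
- have := hW; rewrite /comp /= !cst; exact.
- by rewrite !word_scale_gt0//= !word_scale_lt1// => j; rewrite ?c0 ?c1 ?d0 ?d1.
- by rewrite -word_scale_powR// card_sig.
- by move=> dc; apply: ler_prod => j _; rewrite dc ltW.
- by move=> cd; apply: ler_prod => j _; rewrite cd ltW.
Qed.

Section homogeneous.
Variables (R : realType) (J : finType) (c d : R) (t : J -> R * R).
Variable E : set (R * R).
Hypotheses (c0 : 0 < c) (c1 : c <= 1) (d0 : 0 < d) (d1 : d < 1) (dc : d <= c).
Hypothesis E01 : E `<=` @unit_square R.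
Hypothesis hS : carpet_system (fun=> c) (fun=> d) t E.

(** The words of length [k] form a system of [#|J| ^ k] rectangles with sides
    [c ^+ k] and [d ^+ k], to which packing applies. *)
Lemma homogeneous_cover_needs (t1 u y K : R) k : 0 <= K -> u <= t1 ->
  1 <= #|J|%:R * (c `^ t1 * d `^ y) ->
  cover_needs (@line_dist R) ((d / c) ^+ k) (fst @` E)
    (K * ((d / c) ^+ k) `^ (- u)) ->
  cover_needs (@plane_dist R) (d ^+ k) E (K / 16 * (d ^+ k) `^ (- (y + u))).
Proof.
move=> K0 ut1 hJ hE.
have hW := carpet_system_words k hS.
have cst (z : R) : (fun w : k.-tuple J => word_scale (fun=> z) w) = fun=> z ^+ k.
  apply/funext => w; rewrite /word_scale big_const_seq count_predT size_tuple.
  by rewrite iter_mulr_1.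
rewrite !cst in hW.
have := packing _ E01 hW; rewrite lerXn2r ?nnegrE ?(ltW c0) ?(ltW d0)//.
rewrite -expr_div_n => /(_ isT _ hE); rewrite card_tuple natrX.
apply: cover_needs_mono => //.
rewrite expr_div_n; set C := c ^+ k; set D := d ^+ k.
have C0 : 0 < C by rewrite exprn_gt0.
have D0 : 0 < D by rewrite exprn_gt0.
have C1 : C <= 1 by rewrite exprn_ile1// ltW.
have hJk : 1 <= #|J|%:R ^+ k * (C `^ t1 * D `^ y).
  by rewrite !powR_expr ?(ltW c0) ?(ltW d0)// -!exprMn exprn_ege1.
have hJk' : D `^ (- y) <= #|J|%:R ^+ k * C `^ u.
  apply: (@le_trans _ _ (#|J|%:R ^+ k * C `^ t1)); last first.
    by rewrite ler_wpM2l ?exprn_ge0//; apply: ger_powR; rewrite ?C0.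
  have := ler_wpM2l (powR_ge0 D (- y)) hJk.
  by rewrite mulr1 [X in _ <= _ * X]mulrA mulrCA -powRDp// addNr powRr0 mulr1.
rewrite powRM ?invr_ge0 ?(ltW C0) ?(ltW D0)// powR_invr ?(ltW C0)// opprK.
rewrite opprD powRDp//.
have := ler_wpM2r (mulr_ge0 K0 (powR_ge0 D (- u))) hJk'.
lra.
Qed.

Lemma homogeneous_lower_box_dim (t1 u y K : R) : 0 < K -> u <= t1 ->
  1 <= #|J|%:R * (c `^ t1 * d `^ y) ->
  (forall k, cover_needs (@line_dist R) ((d / c) ^+ k) (fst @` E)
    (K * ((d / c) ^+ k) `^ (- u))) ->
  ((y + u)%:E <= lower_box_dim (@plane_dist R) E)%E.
Proof.
move=> K0 ut1 hJ hE.
apply: (@lower_box_dim_ge_geometric _ _ _ _ (K / 16) d); rewrite ?divr_gt0 ?d0//.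
by move=> k; apply: homogeneous_cover_needs hJ (hE k) => //; exact: ltW.
Qed.

Lemma homogeneous_upper_box_dim (t1 u y K : R) : 0 < K -> u <= t1 ->
  1 <= #|J|%:R * (c `^ t1 * d `^ y) ->
  (forall k0, exists2 k, (k0 <= k)%N &
    cover_needs (@line_dist R) ((d / c) ^+ k) (fst @` E)
      (K * ((d / c) ^+ k) `^ (- u))) ->
  ((y + u)%:E <= upper_box_dim (@plane_dist R) E)%E.
Proof.
move=> K0 ut1 hJ hE.
apply: (@upper_box_dim_ge_geometric _ _ _ _ (K / 16) d); rewrite ?divr_gt0 ?d0//.
move=> k0; have [k kk0 hk] := hE k0; exists k => //.
by apply: homogeneous_cover_needs hJ hk => //; exact: ltW.
Qed.

Lemma homogeneous_lower_box_dim_proj (t1 u y : R) : E !=set0 -> u <= t1 ->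
  1 <= #|J|%:R * (c `^ t1 * d `^ y) ->
  (u%:E < lower_box_dim (@line_dist R) (fst @` E))%E ->
  ((y + u)%:E <= lower_box_dim (@plane_dist R) E)%E.
Proof.
move=> [p Ep] ut1 hJ hu.
have [|K K0 hK] := lower_box_dim_bound _ hu; first by exists p.1, p.
apply: homogeneous_lower_box_dim K0 ut1 hJ _ => k; apply: hK.
rewrite exprn_gt0 ?divr_gt0//= exprn_ile1 ?divr_ge0 ?(ltW c0) ?(ltW d0)//.
by rewrite ler_pdivrMr// mul1r.
Qed.

(** The scales [r] at which the projection needs many sets are arbitrary; each
    one is compared with the next power of [d / c], where the packing bound is
    available. *)
Lemma homogeneous_upper_box_dim_proj (t1 u y : R) : E !=set0 -> u <= t1 ->
  1 <= #|J|%:R * (c `^ t1 * d `^ y) ->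
  (u%:E < upper_box_dim (@line_dist R) (fst @` E))%E ->
  ((y + u)%:E <= upper_box_dim (@plane_dist R) E)%E.
Proof.
move=> [p Ep] ut1 hJ hu.
have E1 : fst @` E !=set0 by exists p.1, p.
pose q := d / c; have q0 : 0 < q by rewrite divr_gt0.
have [q1|q1] := ltP q 1; last first.
  (* all the scales [q ^+ k] are equal to one *)
  have {q0}q1 : q = 1 by apply/le_anti; rewrite q1 ler_pdivrMr// mul1r dc.
  apply: (@homogeneous_upper_box_dim t1 u y 1) => // k0; exists k0 => //.
  by rewrite -/q q1 expr1n powR1 mulr1; exact: cover_needs1.
have q01 : 0 < q < 1 by rewrite q0.
apply: (@homogeneous_upper_box_dim t1 u y (q `^ `|u|)) => //.
  exact: powR_gt0.
move=> k0.
have [r /andP[r0]] := upper_box_dim_gt hu (exprn_gt0 k0 q0).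
move=> rk0 hr.
have r1 : r <= 1.
  by apply: ltW; apply: lt_le_trans rk0 _; rewrite exprn_ile1// ltW.
have [k /andP[kr rk]] := @geometric_bracket _ q r q01 ltac:(by rewrite r0).
exists k.+1.
  rewrite leqNgt; apply/negP => kk0.
  have : q ^+ k0 <= q ^+ k.+1 by rewrite ler_wiXn2l ?(ltW q0) ?(ltW q1)// ltnW.
  by move=> /(lt_le_trans rk0) /lt_le_trans -/(_ _ kr); rewrite ltxx.
have qk0 : 0 < q ^+ k.+1 by rewrite exprn_gt0.
apply: cover_needs_mono hr => //.
have -> : r `^ (- u) = (q ^+ k.+1) `^ (- u) * (q ^+ k.+1 / r) `^ u.
  rewrite powRM ?invr_ge0 ?(ltW qk0) ?(ltW r0)// powR_invr ?(ltW r0)//.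
  by rewrite mulrA -powRDp// addNr powRr0 mul1r.
rewrite mulrC ler_wpM2l ?powR_ge0// powR_ge_abs//.
rewrite ler_pdivlMr// ler_pdivrMr// mul1r kr andbT exprS.
by rewrite ler_wpM2l// ltW.
Qed.

End homogeneous.

(** * Pressure equations and self-similar sets on the line *)

Lemma lee_dense (R : realType) (x y : \bar R) :
  (forall b : R, (b%:E < x)%E -> (b%:E <= y)%E) -> (x <= y)%E.
Proof.
move=> h; rewrite leNgt; apply/negP => yx.
have [b /andP[yb bx]] : exists b : R, (y < b%:E)%E && (b%:E < x)%E.
  case: x y yx {h} => [x| |] [y| |]//=.
  - by rewrite lte_fin => yx; exists ((y + x) / 2); rewrite !lte_fin; apply/andP; split; lra.
  - by move=> _; exists (x - 1); rewrite ltNyr lte_fin; lra.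
  - by move=> _; exists (y + 1); rewrite ltry lte_fin andbT; lra.
  - by move=> _; exists 0; rewrite ltNyr ltry.
by have := h b bx; rewrite leNgt yb.
Qed.

Lemma lower_box_dim_le_image (R : realType) (T T' : Type) (dist : T -> T -> R)
    (dist' : T' -> T' -> R) (f : T -> T') (E : set T) :
  (forall y z, dist' (f y) (f z) <= dist y z) ->
  (lower_box_dim dist' (f @` E) <= lower_box_dim dist E)%E.
Proof.
move=> hf; apply: lee_dense => b /lower_box_dim_gt[r0 r00 h].
apply: (@lower_box_dim_ge _ _ _ _ 1 r0) => // r /h hr.
by rewrite mul1r; exact: cover_needs_image hr.
Qed.

Lemma upper_box_dim_le_image (R : realType) (T T' : Type) (dist : T -> T -> R)
    (dist' : T' -> T' -> R) (f : T -> T') (E : set T) :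
  (forall y z, dist' (f y) (f z) <= dist y z) ->
  (upper_box_dim dist' (f @` E) <= upper_box_dim dist E)%E.
Proof.
move=> hf; apply: lee_dense => b /upper_box_dim_gt h.
apply: (@upper_box_dim_ge _ _ _ _ 1) => // r0 /h[r rr0 hr]; exists r => //.
by rewrite mul1r; exact: cover_needs_image hr.
Qed.

Lemma lower_box_dim_sub (R : realType) (T : Type) (dist : T -> T -> R)
    (E E' : set T) : E `<=` E' ->
  (lower_box_dim dist E <= lower_box_dim dist E')%E.
Proof.
move=> EE'; apply: lee_dense => b /lower_box_dim_gt[r0 r00 h].
apply: (@lower_box_dim_ge _ _ _ _ 1 r0) => // r /h hr.
by rewrite mul1r; exact: cover_needs_mono hr.
Qed.

Lemma upper_box_dim_sub (R : realType) (T : Type) (dist : T -> T -> R)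
    (E E' : set T) : E `<=` E' ->
  (upper_box_dim dist E <= upper_box_dim dist E')%E.
Proof.
move=> EE'; apply: lee_dense => b /upper_box_dim_gt h.
apply: (@upper_box_dim_ge _ _ _ _ 1) => // r0 /h[r rr0 hr]; exists r => //.
by rewrite mul1r; exact: cover_needs_mono hr.
Qed.

Lemma unit_interval_bounds (R : realType) (I : finType) (f : I -> R) :
  (forall i, 0 < f i < 1) ->
  exists m M, [/\ 0 < m, M < 1 & forall i, m <= f i <= M].
Proof.
move=> hf.
have le (g : I -> R) i : (forall j, 0 < g j < 1) -> \prod_j g j <= g i.
  move=> hg; have g0 j : 0 < g j by have /andP[] := hg j.
  rewrite (bigD1 i)//= ler_piMr ?(ltW (g0 _))// prodr_ile1// => j _.
  by have /andP[/ltW -> /ltW ->] := hg j.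
have hf' j : 0 < 1 - f j < 1.
  by have /andP[f0 f1] := hf j; rewrite subr_gt0 f1 ltrBlDr ltrDl.
exists (\prod_j f j), (1 - \prod_j (1 - f j)); split.
- by apply: prodr_gt0 => j _; have /andP[] := hf j.
- by rewrite ltrBlDr ltrDl; apply: prodr_gt0 => j _; have /andP[] := hf' j.
- by move=> i; rewrite le// lerBrDr addrC -lerBrDr le.
Qed.

Section pressure.
Variables (R : realType) (I : finType) (a b : I -> R) (t : R).
Hypotheses (I0 : (0 < #|I|)%N) (a0 : forall i, 0 < a i).
Hypothesis b01 : forall i, 0 < b i < 1.

Let b0 i : 0 < b i. Proof. by have /andP[] := b01 i. Qed.

Let pressure s : R := \sum_i a i `^ t * b i `^ (s - t).

Let i0 : I. Proof. by have /card_gt0P/sigW[] := I0. Qed.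

Lemma pressure_decreasing s s' : s < s' -> pressure s' < pressure s.
Proof.
move=> ss'; apply: ltr_sum; first by apply/hasP; exists i0; rewrite ?mem_index_enum.
move=> i _; rewrite ltr_pM2l ?powR_gt0//.
have -> : s' - t = (s - t) + (s' - s) by ring.
rewrite powRDp// gtr_pMr ?powR_gt0//.
have /andP[_ b1] := b01 i.
by rewrite /powR gt_eqF// -expR0 ltr_expR pmulr_rlt0 ?subr_gt0// ln_lt0// b0.
Qed.

Let pressure_continuous : continuous pressure.
Proof.
have term_continuous i : continuous (fun s : R => a i `^ t * b i `^ (s - t)).
  move=> s; apply: cvgM; first exact: cvg_cst.
  have -> : powR (b i) = (fun u => expR (u * ln (b i))).
    by apply/funext => u; rewrite /powR gt_eqF.
  apply: (@cvg_comp _ _ _ (fun s => (s - t) * ln (b i)) expR _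
    (nbhs ((s - t) * ln (b i)))); last exact: continuous_expR.
  by apply: cvgM; [apply: cvgB; [exact: cvg_id|exact: cvg_cst]|exact: cvg_cst].
apply: continuous_big => [|i _]; last exact: term_continuous.
by move=> u; exact: add_continuous.
Qed.

(** Each term can be given any positive value by a suitable exponent, which
    provides exponents where the sum is at least one and at most one; then the
    intermediate value theorem applies. *)
Lemma pressure_root_exists : exists s, pressure s = 1.
Proof.
pose n : R := #|I|%:R; have n0 : 0 < n by rewrite ltr0n.
have lb i : ln (b i) != 0 by rewrite lt_eqF// ln_lt0.
pose root (v : R) i := t + (ln v - t * ln (a i)) / ln (b i).
have rootE v i : 0 < v -> a i `^ t * b i `^ (root v i - t) = v.
  move=> v0; rewrite /powR !gt_eqF// -expRD /root addrAC subrr add0r divfK//.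
  by rewrite addrC subrK lnK ?posrE.
have lo : 1 <= pressure (root 1 i0).
  rewrite /pressure (bigD1 i0)//= rootE// lerDl sumr_ge0// => i _.
  by rewrite mulr_ge0 ?powR_ge0.
pose hi := \sum_i `|root n^-1 i| + `|root 1 i0|.
have hi_ge i : root n^-1 i <= hi.
  rewrite /hi (bigD1 i)//= -addrA; apply: le_trans (ler_norm _) _.
  by rewrite lerDl addr_ge0// sumr_ge0.
have lohi : root 1 i0 <= hi.
  by apply: le_trans (ler_norm _) _; rewrite lerDr sumr_ge0.
have up : pressure hi <= 1.
  rewrite (_ : 1 = \sum_(i : I) n^-1); last first.
    by rewrite sumr_const -mulr_natl divff// gt_eqF.
  apply: ler_sum => i _; rewrite -[leRHS](@rootE n^-1 i) ?invr_gt0//.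
  rewrite ler_pM2l ?powR_gt0//; apply: ger_powR; last by rewrite lerD2r.
  by have /andP[-> /ltW ->] := b01 i.
have hc : {within `[root 1 i0, hi], continuous pressure}.
  by apply: continuous_subspaceT; exact: pressure_continuous.
have hb : Num.min (pressure (root 1 i0)) (pressure hi) <= 1
    <= Num.max (pressure (root 1 i0)) (pressure hi).
  by rewrite ge_min up orbT le_max lo.
by have [s _ hs] := IVT lohi hc hb; exists s.
Qed.

Lemma pressure_rootP : pressure (pressure_root a b t) = 1.
Proof. by have /getPex := pressure_root_exists. Qed.

Lemma pressure_gt1 s : s < pressure_root a b t -> 1 < pressure s.
Proof. by move=> h; rewrite -pressure_rootP; exact: pressure_decreasing. Qed.

Lemma pressure_lt1 s : pressure_root a b t < s -> pressure s < 1.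
Proof. by move=> h; rewrite -pressure_rootP; exact: pressure_decreasing. Qed.

End pressure.

(** The counterpart of a carpet system on the line. *)
Record column_system (R : realType) (K : finType) (a x : K -> R) (E : set R) :
    Prop := ColumnSystem {
  column_scale : forall k, 0 < a k < 1;
  column_interval : forall k, 0 <= x k /\ x k + a k <= 1;
  column_apart : forall k l, k != l -> apart (a k) (x k) (a l) (x l);
  column_stable : forall k, (fun y => a k * y + x k) @` E `<=` E
}.

Section column_dimension.
Variables (R : realType) (K : finType) (a x : K -> R).
Hypothesis K0 : (0 < #|K|)%N.

Definition similarity_dim : R := pressure_root a a 0.

Lemma similarity_sumE s : (forall k, 0 < a k) ->
  \sum_k a k `^ 0 * a k `^ (s - 0) = \sum_k a k `^ s.
Proof. by move=> a0; apply: eq_bigr => k _; rewrite powRr0 mul1r subr0. Qed.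

(** The set [E * {0}] is stable under the square maps of ratios [a k], a planar
    system whose rectangles are squares. For these the projection is only used
    at scale one, and the planar lower bound reads off the similarity
    dimension. *)
Lemma column_lower_box_dim (E : set R) : column_system a x E -> E `<=` `[0, 1] ->
  E !=set0 -> (similarity_dim%:E <= lower_box_dim (@line_dist R) E)%E.
Proof.
move=> [ha hx hap hst] E01 E0.
have a0 k : 0 < a k by have /andP[] := ha k.
have a1 k : a k < 1 by have /andP[] := ha k.
pose E' : set (R * R) := (fun y => (y, 0)) @` E.
have hS : carpet_system a a (fun k => (x k, 0)) E'.
  split=> [k|k|k|k l kl|k _ [_ [y Ey <-] <-]].
  - by rewrite a0 ltW.
  - by rewrite a0 ltW.
  - by have [? ?] := hx k; split=> //=; rewrite add0r ltW.
  - by left; exact: hap.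
  - exists (a k * y + x k); first by apply: (hst k); exists y.
    by rewrite /diag_map/= mulr0 addr0.
apply: (@le_trans _ _ (lower_box_dim (@plane_dist R) E')); last first.
  apply: lower_box_dim_le_image => y z.
  by rewrite /plane_dist/line_dist/= subrr expr0n/= addr0 sqrtr_sqr.
apply: lee_dense => s; rewrite lte_fin => hs.
have : 1 < \sum_k a k `^ s * a k `^ 0.
  under eq_bigr do rewrite powRr0 mulr1.
  by rewrite -similarity_sumE//; exact: pressure_gt1.
move=> /(homogeneous_subsystem hS a1 a1).
move=> [J [c [d [t [hJ [/andP[c0 c1] /andP[d0 d1]] hc dc cd]]]]].
have {dc cd}ecd : d = c by apply/le_anti; rewrite dc// cd.
move: hJ d0 d1 hc; rewrite ecd => hJ d0 d1 hc.
rewrite -[s]add0r.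
apply: (@homogeneous_lower_box_dim R J c c t E' c0 (ltW c1) c0 c1 (lexx c) _ hJ
  s s 0 1) => //.
  move=> _ [y /E01 /= + <-]; rewrite in_itv/= => y01.
  by split; rewrite /= in_itv/= ?lexx ?ler01.
move=> k; rewrite divff ?gt_eqF// expr1n powR1 mulr1; apply: cover_needs1.
by have [y Ey] := E0; exists y, (y, 0) => //; exists y.
Qed.

Lemma similarity_dim_ge0 : (forall k, 0 < a k < 1) -> 0 <= similarity_dim.
Proof.
move=> ha; have a0 k : 0 < a k by have /andP[] := ha k.
have /card_gt0P[k0 _] := K0.
rewrite leNgt; apply/negP => /(pressure_lt1 K0 a0 ha).
rewrite similarity_sumE// (bigD1 k0)//= powRr0 ltNge lerDl sumr_ge0// => k _.
exact: powR_ge0.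
Qed.

Lemma column_sum_le1 t : (forall k, 0 < a k < 1) -> similarity_dim <= t ->
  \sum_k a k `^ t <= 1.
Proof.
move=> ha; have a0 k : 0 < a k by have /andP[] := ha k.
rewrite -similarity_sumE// le_eqVlt => /orP[/eqP <-|/(pressure_lt1 K0 a0 ha)/ltW//].
by rewrite (pressure_rootP _ K0 a0 ha).
Qed.

Lemma column_sum_lt1 t : (forall k, 0 < a k < 1) -> similarity_dim < t ->
  \sum_k a k `^ t < 1.
Proof.
move=> ha; have a0 k : 0 < a k by have /andP[] := ha k.
by rewrite -similarity_sumE// => /(pressure_lt1 K0 a0 ha).
Qed.

(** The upper bound is the recursion over intervals, with an empty condensation
    set. *)
Lemma column_box_dim (E : set R) : column_system a x E -> E `<=` `[0, 1] ->
  E !=set0 -> E `<=` \bigcup_(k in [set: K]) ((fun y => a k * y + x k) @` E) ->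
  box_dim (@line_dist R) E = similarity_dim.
Proof.
move=> hE E01 E0 Esub; have ha := column_scale hE.
have lo := column_lower_box_dim hE E01 E0.
have up : (upper_box_dim (@line_dist R) E <= similarity_dim%:E)%E.
  apply/lee_addgt0Pr => e e0; rewrite -EFinD.
  have [m [M [m0 M1 mM]]] := unit_interval_bounds ha.
  have /card_gt0P[k0 _] := K0.
  have M0 : 0 < M by have /andP[/le_trans h /h] := mM k0; exact: lt_le_trans.
  have t0 : 0 <= similarity_dim + e by rewrite addr_ge0 ?similarity_dim_ge0// ltW.
  have tsum := column_sum_lt1 ha (_ : similarity_dim < similarity_dim + e).
  have M01 : 0 < M < 1 by rewrite M0.
  have [|y z Ey Ez| |r _|K' K'0 hK'] := selfsimilar_coverable (C := set0) (E := E)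
    (tau := x) m0 M01 mM t0 (lexx 0) (tsum _).
  - by rewrite ltrDl.
  - have := E01 _ Ey; have := E01 _ Ez; rewrite /= !in_itv/=.
    by move=> /andP[? ?] /andP[? ?]; rewrite ler_norml; apply/andP; split; lra.
  - by rewrite setU0.
  - by rewrite mul0r; exact: coverable_set0.
  apply: (@upper_box_dim_le _ _ _ _ K' m^-1) => //; first by rewrite invr_gt0.
  by move=> r /andP[r0 rm]; apply: hK'; rewrite r0 ltW.
have lo_up := lower_le_upper_box_dim (@line_dist R) E.
have lE : lower_box_dim (@line_dist R) E = similarity_dim%:E.
  by apply/le_anti; rewrite lo (le_trans lo_up).
have uE : upper_box_dim (@line_dist R) E = similarity_dim%:E.
  by apply/le_anti; rewrite up (le_trans lo).
have /getPex[] : exists s : R, lower_box_dim (@line_dist R) E = s%:E /\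
  upper_box_dim (@line_dist R) E = s%:E by exists similarity_dim.
by move=> h _; apply: EFin_inj; rewrite -lE; exact: (esym h).
Qed.

End column_dimension.

Definition in_columns (R : realType) (I : finType) (a x : I -> R) : Prop :=
  forall i j, (a i = a j /\ x i = x j) \/ apart (a i) (x i) (a j) (x j).

(** Maps sharing the same projected interval are identified: the index set is
    the finite set of the distinct pairs (length, position). *)
Lemma distinct_columns (R : realType) (I : finType) (a x : I -> R) :
  in_columns a x -> exists (K : finType) (g : I -> K) (b y : K -> R),
    [/\ forall i, b (g i) = a i, forall i, y (g i) = x i,
        forall k, exists i, g i = k &
        forall k l, k != l -> apart (b k) (y k) (b l) (y l)].
Proof.
move=> h; pose f i : R * R := (a i, x i).
pose g i : seq_sub (codom f) := SeqSub (codom_f f i).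
have gP k : exists i, g i = k.
  by case: k => p pf; have [i e] := codomP pf; exists i; apply/val_inj.
exists (seq_sub (codom f)), g, (fun k => (val k).1), (fun k => (val k).2).
split=> // k l; have [i <-] := gP k; have [j <-] := gP l => kl.
have [[ea ex]|//] := h i j.
by case/eqP: kl; apply/val_inj; rewrite /= /f ea ex.
Qed.

(** At a point close to the supremum [s > 1] of [E], one of the maps would send
    [E] at most to [1 + c i * (s - 1)], which is less than [s] by a fixed
    proportion. *)
Lemma attractor_le1 (R : realType) (I : finType) (c x : I -> R) (E C : set R) :
  (forall i, 0 < c i < 1) -> has_ubound E ->
  (forall i, x i + c i <= 1) -> (forall y, C y -> y <= 1) ->
  E `<=` (\bigcup_(i in [set: I]) ((fun y => c i * y + x i) @` E)) `|` C ->
  forall y, E y -> y <= 1.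
Proof.
move=> c01 ubE xc C1 hE y Ey.
have [m [M [m0 M1 mM]]] := unit_interval_bounds c01.
have supE : has_sup E by split=> //; exists y.
have le_sup z : E z -> z <= sup E by move=> Ez; exact: sup_upper_bound.
apply: le_trans (le_sup _ Ey) _.
rewrite leNgt; apply/negP => s1.
have : sup E <= 1 + Num.max 0 M * (sup E - 1); last first.
  have : Num.max 0 M < 1 by rewrite gt_max ltr01.
  move: (Num.max 0 M) => q q1; have : 0 < (1 - q) * (sup E - 1).
    by rewrite mulr_gt0 ?subr_gt0.
  lra.
have p0 : 0 <= Num.max 0 M * (sup E - 1).
  by rewrite mulr_ge0 ?le_max ?lexx ?subr_ge0 ?(ltW s1).
apply: sup_le_ub; first by exists y.
move=> z /hE[[i _ [w Ew <-]]|/C1]; last by move: p0; lra.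
have ws := le_sup _ Ew.
have /andP[c0 _] := c01 i; have /andP[_ ciM] := mM i.
have : c i * (sup E - 1) <= Num.max 0 M * (sup E - 1).
  by rewrite ler_wpM2r ?subr_ge0 ?(ltW s1)// le_max ciM orbT.
have := ler_wpM2l (ltW c0) ws; have := xc i; lra.
Qed.

Lemma attractor_unit_interval (R : realType) (I : finType) (c x : I -> R)
    (E C : set R) : (forall i, 0 < c i < 1) -> has_ubound E -> has_lbound E ->
  (forall i, 0 <= x i /\ x i + c i <= 1) -> C `<=` `[0, 1] ->
  E `<=` (\bigcup_(i in [set: I]) ((fun y => c i * y + x i) @` E)) `|` C ->
  E `<=` `[0, 1].
Proof.
move=> c01 ubE lbE hx C01 hE y Ey; rewrite /= in_itv/=; apply/andP; split; last first.
  apply: (attractor_le1 c01 ubE _ _ hE) => // [i|z /C01]; first by have [] := hx i.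
  by rewrite /= in_itv/= => /andP[].
(* the lower bound is the upper bound for the reflected set *)
have : 1 - y <= 1; last by lra.
apply: (@attractor_le1 R I c (fun i => 1 - c i - x i) ((fun z => 1 - z) @` E)
   ((fun z => 1 - z) @` C)).
- exact: c01.
- have [u lb] := lbE; exists (1 - u) => _ [z Ez <-].
  by have := lb _ Ez; lra.
- by move=> i; have [] := hx i; lra.
- by move=> _ [z /C01 + <-]; rewrite /= in_itv/= => /andP[]; lra.
- move=> _ [z Ez <-]; have [[i _ [w Ew <-]]|Cz] := hE _ Ez; last first.
    by right; exists z.
  left; exists i => //; exists (1 - w); first by exists w.
  ring.
- by exists y.
Qed.

Lemma compact_fst_bounded (R : realType) (F : set (R * R)) : compact F ->
  has_ubound (fst @` F) /\ has_lbound (fst @` F).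
Proof.
move=> cF; have : compact (fst @` F).
  apply: continuous_compact => //; apply: continuous_subspaceT => p.
  exact: cvg_fst.
move=> /compact_bounded [M [_ hM]].
have hb y : (fst @` F) y -> `|y| <= M + 1 by apply: hM; rewrite ltrDl.
by split; [exists (M + 1) | exists (- (M + 1))] => y /hb; rewrite ler_norml => /andP[].
Qed.

Lemma compact_snd_bounded (R : realType) (F : set (R * R)) : compact F ->
  has_ubound (snd @` F) /\ has_lbound (snd @` F).
Proof.
move=> cF; have : compact (snd @` F).
  apply: continuous_compact => //; apply: continuous_subspaceT => p.
  exact: cvg_snd.
move=> /compact_bounded [M [_ hM]].
have hb y : (snd @` F) y -> `|y| <= M + 1 by apply: hM; rewrite ltrDl.
by split; [exists (M + 1) | exists (- (M + 1))] => y /hb; rewrite ler_norml => /andP[].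
Qed.

(** * Carpets and their projections *)

Record carpet_shape (R : realType) (I : finType) (c d : I -> R)
    (t : I -> R * R) : Prop := CarpetShape {
  shape_nonempty : (0 < #|I|)%N;
  shape_hscale : forall i, 0 < c i < 1;
  shape_vscale : forall i, 0 < d i < 1;
  shape_square : forall i, [/\ 0 <= (t i).1, (t i).1 + c i <= 1,
    0 <= (t i).2 & (t i).2 + d i <= 1];
  shape_apart : forall i j, i != j ->
    apart (c i) (t i).1 (c j) (t j).1 \/ apart (d i) (t i).2 (d j) (t j).2
}.

Record carpet_attractor (R : realType) (I : finType) (c d : I -> R)
    (t : I -> R * R) (C F : set (R * R)) : Prop := CarpetAttractor {
  attractor_square : F `<=` @unit_square R;
  attractor_nonempty : F !=set0;
  attractorE : F =
    (\bigcup_(i in [set: I]) (diag_map (c i) (d i) (t i) @` F)) `|` C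
}.

Section transposition.
Variables (R : realType) (I : finType) (c d : I -> R) (t : I -> R * R).
Implicit Types C F : set (R * R).

Lemma carpet_shape_transpose : carpet_shape c d t ->
  carpet_shape d c (transpose \o t).
Proof.
move=> [I0 hc hd hsq hap]; split=> //.
  by move=> i; have [] := hsq i.
by move=> i j /hap[] ?; [right|left].
Qed.

Lemma unit_square_transpose F : F `<=` @unit_square R ->
  transpose @` F `<=` @unit_square R.
Proof. by move=> h _ [p /h[? ?] <-]; split. Qed.

Lemma carpet_attractor_transpose C F : carpet_attractor c d t C F ->
  carpet_attractor d c (transpose \o t) (transpose @` C) (transpose @` F).
Proof.
move=> [Fsq [p Fp] FE]; split; first exact: unit_square_transpose.
  by exists (transpose p), p.
rewrite {1}FE image_setU image_bigcup; congr (_ `|` _).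
apply: eq_bigcupr => i _; rewrite !image_comp; apply: eq_imagel => q _ /=.
by rewrite transpose_diag_map.
Qed.

Lemma lower_box_dim_transpose F :
  lower_box_dim (@plane_dist R) (transpose @` F)
  = lower_box_dim (@plane_dist R) F.
Proof.
apply/le_anti; rewrite lower_box_dim_le_image/=; last first.
  by move=> p q; rewrite plane_dist_transpose.
rewrite -{1}(image_transposeK F) lower_box_dim_le_image// => p q.
by rewrite plane_dist_transpose.
Qed.

Lemma upper_box_dim_transpose F :
  upper_box_dim (@plane_dist R) (transpose @` F)
  = upper_box_dim (@plane_dist R) F.
Proof.
apply/le_anti; rewrite upper_box_dim_le_image/=; last first.
  by move=> p q; rewrite plane_dist_transpose.
rewrite -{1}(image_transposeK F) upper_box_dim_le_image// => p q.
by rewrite plane_dist_transpose.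
Qed.

End transposition.

Section projection.
Variables (R : realType) (I : finType) (c d : I -> R) (t : I -> R * R).
Hypothesis hS : carpet_shape c d t.
Implicit Types C F : set (R * R).

Lemma attractor_carpet_system C F : carpet_attractor c d t C F ->
  carpet_system c d t F.
Proof.
move=> [_ _ FE]; split.
- by move=> i; have /andP[-> /ltW ->] := shape_hscale hS i.
- by move=> i; have /andP[-> /ltW ->] := shape_vscale hS i.
- exact: shape_square hS.
- exact: shape_apart hS.
- by move=> i p Fp; rewrite FE; left; exists i.
Qed.

Lemma fst_unit_interval F : F `<=` @unit_square R -> fst @` F `<=` `[0, 1].
Proof. by move=> h _ [p /h[+ _] <-]. Qed.

Lemma fst_attractor C F : carpet_attractor c d t C F -> fst @` F =
  (\bigcup_(i in [set: I]) ((fun y => c i * y + (t i).1) @` (fst @` F)))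
  `|` fst @` C.
Proof.
move=> [_ _ FE]; rewrite {1}FE image_setU image_bigcup; congr (_ `|` _).
by apply: eq_bigcupr => i _; rewrite !image_comp.
Qed.

(** The distinct columns of a carpet, [g] sending a map to its column; their
    intervals give a system of similarities for every projected attractor. *)
Record column_model (K : finType) (g : I -> K) (b y : K -> R) : Prop :=
  ColumnModel {
  model_scale : forall i, b (g i) = c i;
  model_shift : forall i, y (g i) = (t i).1;
  model_surjective : forall k, exists i, g i = k;
  model_scale_range : forall k, 0 < b k < 1;
  model_stable : forall C F, carpet_attractor c d t C F ->
    column_system b y (fst @` F);
  model_cover : forall C F, carpet_attractor c d t C F -> fst @` F `<=`
    (\bigcup_(k in [set: K]) ((fun z => b k * z + y k) @` (fst @` F)))
    `|` fst @` C
}.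

Lemma column_model_exists : in_columns c (fun i => (t i).1) ->
  exists (K : finType) (g : I -> K) (b y : K -> R), column_model g b y.
Proof.
move=> hcol.
have [K [g [b [y [bg yg gsurj hap]]]]] := distinct_columns hcol.
have hb k : 0 < b k < 1.
  by have [i <-] := gsurj k; rewrite bg; exact: shape_hscale hS i.
exists K, g, b, y; split=> //.
- move=> C F hF; split=> // k; have [i <-] := gsurj k; rewrite ?bg ?yg.
    by have [] := shape_square hS i.
  by rewrite [X in _ `<=` X](fst_attractor hF) => z Fz; left; exists i.
- move=> C F hF; rewrite {1}(fst_attractor hF) => z [[i _ Fz]|Cz].
    by left; exists (g i) => //; rewrite bg yg.
  by right.
Qed.

Variables (K : finType) (g : I -> K) (b y : K -> R).
Hypothesis hK : column_model g b y.

Lemma model_nonempty : (0 < #|K|)%N.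
Proof.
by have /card_gt0P[i _] := shape_nonempty hS; apply/card_gt0P; exists (g i).
Qed.

Lemma projected_box_dim F0 : carpet_attractor c d t set0 F0 ->
  box_dim (@line_dist R) (fst @` F0) = similarity_dim b.
Proof.
move=> hF0.
apply: (column_box_dim model_nonempty (model_stable hK hF0)).
- exact: fst_unit_interval (attractor_square hF0).
- by have [p Fp] := attractor_nonempty hF0; exists p.1, p.
- by have := model_cover hK hF0; rewrite image_set0 setU0.
Qed.

(** The lower bound uses only the stability under the columns, so it holds for
    the projection of the inhomogeneous attractor as well. *)
Lemma projected_lower_box_dim C F : carpet_attractor c d t C F ->
  ((similarity_dim b)%:E <= lower_box_dim (@line_dist R) (fst @` F))%E.
Proof.
move=> hF; apply: (column_lower_box_dim model_nonempty (model_stable hK hF)).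
  exact: fst_unit_interval (attractor_square hF).
by have [p Fp] := attractor_nonempty hF; exists p.1, p.
Qed.

Lemma projected_coverable C F (m M u K0 : R) : carpet_attractor c d t C F ->
  0 < m -> 0 < M < 1 -> (forall i, m <= c i <= M) -> 0 <= K0 ->
  similarity_dim b < u ->
  (forall r, 0 < r <= 1 ->
    coverable (@line_dist R) r (fst @` C) (K0 * r `^ (- u))) ->
  exists2 K', 0 < K' & forall r, 0 < r <= m^-1 ->
    coverable (@line_dist R) r (fst @` F) (K' * r `^ (- u)).
Proof.
move=> hF m0 M01 hm K00 bu hC.
have hb k : m <= b k <= M.
  by have [i <-] := model_surjective hK k; rewrite (model_scale hK).
have u0 : 0 <= u.
  apply: le_trans (ltW bu).
  exact: similarity_dim_ge0 model_nonempty (model_scale_range hK).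
have bsum := column_sum_lt1 model_nonempty (model_scale_range hK) bu.
have F01 := fst_unit_interval (attractor_square hF).
have F1 z w : (fst @` F) z -> (fst @` F) w -> `|z - w| <= 1.
  move=> /F01 /= + /F01 /=; rewrite !in_itv/= ler_norml.
  by move=> /andP[? ?] /andP[? ?]; apply/andP; split; lra.
exact: (selfsimilar_coverable m0 M01 hb u0 K00 bsum F1 (model_cover hK hF) hC).
Qed.

End projection.

Section exponents.
Variables (R : realType) (I : finType) (c d : I -> R) (t : I -> R * R).
Variables (C F0 FC : set (R * R)).
Hypothesis hS : carpet_shape c d t.
Hypothesis hcol : in_columns c (fun i => (t i).1).
Hypothesis (C0 : C !=set0) (C01 : C `<=` @unit_square R).
Hypothesis hF0 : carpet_attractor c d t set0 F0.
Hypothesis hFC : carpet_attractor c d t C FC.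

Let pC0 : fst @` C !=set0. Proof. by have [p Cp] := C0; exists p.1, p. Qed.

Let pC01 : fst @` C `<=` `[0, 1]. Proof. exact: fst_unit_interval. Qed.

Let pCF : fst @` C `<=` fst @` FC.
Proof. by rewrite (fst_attractor hFC) => z Cz; right. Qed.

Lemma projected_dims_fin : lower_box_dim (@line_dist R) (fst @` C) \is a fin_num
  /\ upper_box_dim (@line_dist R) (fst @` C) \is a fin_num.
Proof.
have l0 := lower_box_dim_ge0 (@line_dist R) pC0.
have lu := lower_le_upper_box_dim (@line_dist R) (fst @` C).
have u1 := upper_box_dim_unit_interval pC01.
split; apply/fin_numPlt; apply/andP; split.
- exact: lt_le_trans (ltNyr _) l0.
- exact: le_lt_trans (le_trans lu u1) (ltry _).
- exact: lt_le_trans (ltNyr _) (le_trans l0 lu).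
- exact: le_lt_trans u1 (ltry _).
Qed.

Lemma t_lower_le u : u < t_lower F0 C fst ->
  (u%:E < lower_box_dim (@line_dist R) (fst @` FC))%E.
Proof.
have [K [g [b [y hK]]]] := column_model_exists hS hcol.
rewrite /t_lower (projected_box_dim hS hK hF0) lt_max => /orP[us|ul].
  apply: lt_le_trans (projected_lower_box_dim hS hK hFC).
  by rewrite lte_fin.
apply: lt_le_trans (lower_box_dim_sub _ pCF).
by have [lf _] := projected_dims_fin; rewrite -(fineK lf) lte_fin.
Qed.

Lemma t_upper_le u : u < t_upper F0 C fst ->
  (u%:E < upper_box_dim (@line_dist R) (fst @` FC))%E.
Proof.
have [K [g [b [y hK]]]] := column_model_exists hS hcol.
rewrite /t_upper (projected_box_dim hS hK hF0) lt_max => /orP[us|ul].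
  apply: lt_le_trans (lower_le_upper_box_dim _ _).
  apply: lt_le_trans (projected_lower_box_dim hS hK hFC).
  by rewrite lte_fin.
apply: lt_le_trans (upper_box_dim_sub _ pCF).
by have [_ uf] := projected_dims_fin; rewrite -(fineK uf) lte_fin.
Qed.

Lemma t_upper_ge0 : 0 <= t_upper F0 C fst.
Proof.
have [K [g [b [y hK]]]] := column_model_exists hS hcol.
rewrite /t_upper (projected_box_dim hS hK hF0) le_max.
by rewrite (similarity_dim_ge0 (model_nonempty hS g) (model_scale_range hK)).
Qed.

Lemma homogeneous_t_lower (J : finType) (c' d' : R) (t' : J -> R * R) (y : R) :
  carpet_system (fun=> c') (fun=> d') t' FC -> 0 < c' < 1 -> 0 < d' < 1 ->
  d' <= c' -> 1 <= #|J|%:R * (c' `^ t_lower F0 C fst * d' `^ y) ->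
  ((y + t_lower F0 C fst)%:E <= lower_box_dim (@plane_dist R) FC)%E.
Proof.
move=> hJ /andP[c0 c1] /andP[d0 d1] dc hc; apply: lee_dense => s.
rewrite lte_fin -ltrBlDl => /[dup] /ltW su /t_lower_le h.
rewrite -[s](subrK y) [_ - _ + _]addrC.
exact: (homogeneous_lower_box_dim_proj c0 (ltW c1) d0 d1 dc
  (attractor_square hFC) hJ (attractor_nonempty hFC) su hc h).
Qed.

Lemma homogeneous_t_upper (J : finType) (c' d' : R) (t' : J -> R * R) (y : R) :
  carpet_system (fun=> c') (fun=> d') t' FC -> 0 < c' < 1 -> 0 < d' < 1 ->
  d' <= c' -> 1 <= #|J|%:R * (c' `^ t_upper F0 C fst * d' `^ y) ->
  ((y + t_upper F0 C fst)%:E <= upper_box_dim (@plane_dist R) FC)%E.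
Proof.
move=> hJ /andP[c0 c1] /andP[d0 d1] dc hc; apply: lee_dense => s.
rewrite lte_fin -ltrBlDl => /[dup] /ltW su /t_upper_le h.
rewrite -[s](subrK y) [_ - _ + _]addrC.
exact: (homogeneous_upper_box_dim_proj c0 (ltW c1) d0 d1 dc
  (attractor_square hFC) hJ (attractor_nonempty hFC) su hc h).
Qed.

(** The two estimates feeding the recursion over cylinders, for the rectangles
    that are at least as wide as they are high. *)
Lemma wide_rectangles_coverable (m M u beta : R) :
  0 < m -> 0 < M < 1 -> (forall i, m <= c i <= M) ->
  t_upper F0 C fst < u -> 0 <= beta ->
  (upper_box_dim (@plane_dist R) C < beta%:E)%E ->
  assouad_condition F0 C fst ->
  (exists2 KF : R, 0 <= KF & forall x y r s, 0 < r -> y <= x ->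
     m * r <= y <= r -> coverable (@plane_dist R) (2 * r)
       (diag_map x y s @` FC) (KF * r `^ (- beta) * (x `^ u * y `^ (beta - u)))) /\
  (exists2 KC : R, 0 <= KC & forall x y r s, 0 < r <= y -> y <= x -> x <= 1 ->
     coverable (@plane_dist R) (2 * r)
       (diag_map x y s @` C) (KC * r `^ (- beta) * (x `^ u * y `^ (beta - u)))).
Proof.
move=> m0 M01 hm tu beta0 Cbeta hA.
have [K [g [b [y hK]]]] := column_model_exists hS hcol.
have sb := projected_box_dim hS hK hF0.
have u0 : 0 <= u := le_trans t_upper_ge0 (ltW tu).
have [_ uf] := projected_dims_fin.
move: tu; rewrite /t_upper gt_max sb => /andP[su pu].
have pCu : (upper_box_dim (@line_dist R) (fst @` C) < u%:E)%E.
  by rewrite -(fineK uf) lte_fin.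
have aCu : (assouad_dim (@line_dist R) (fst @` C) < u%:E)%E.
  by apply: le_lt_trans hA _; rewrite gt_max pCu sb lte_fin.
have [K1 K10 hK1] := upper_box_dim_bound u0 pCu.
have [KP KP0 hKP] := projected_coverable hS hK hFC m0 M01 hm (ltW K10) su hK1.
have [K2 K20 hK2] := upper_box_dim_bound beta0 Cbeta.
have [K3 K30 hK3] := assouad_dim_bound pC01 u0 aCu.
split.
  exists (KP * m `^ (- `|u - beta|)); first by rewrite mulr_ge0 ?powR_ge0// ltW.
  move=> x z r s r0 zx hz; apply: thin_coverable => //; first exact: ltW.
  move=> p q /(attractor_square hFC)[_ +] /(attractor_square hFC)[_].
  rewrite /= !in_itv/= => /andP[? ?] /andP[? ?].
  by rewrite ler_norml; apply/andP; split; lra.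
exists (K2 * K3); first by rewrite mulr_ge0 ?ltW.
move=> x z r s rz zx x1.
by apply: stretched_coverable => //; exact: ltW.
Qed.

End exponents.

(** * Lower bounds by pressure *)

(** Moving weight from the short side to the long side increases it. *)
Lemma tilt_le (R : realType) (c d x u s : R) : 0 < d -> d <= c -> x <= u ->
  c `^ x * d `^ (s - x) <= c `^ u * d `^ (s - u).
Proof.
move=> d0 dc xu; have c0 := lt_le_trans d0 dc.
have -> : c `^ u = c `^ x * c `^ (u - x) by rewrite -powRDp//; congr powR; ring.
have -> : d `^ (s - x) = d `^ (u - x) * d `^ (s - u).
  by rewrite -powRDp//; congr powR; ring.
rewrite mulrA ler_wpM2r ?powR_ge0// ler_wpM2l ?powR_ge0//.
by rewrite ge0_ler_powR ?nnegrE ?subr_ge0 ?(ltW d0) ?(ltW c0).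
Qed.

(** Abstracts the lower and the upper bounds: [L] is the lower or the upper box
    dimension of [E], and [u] the exponent governing the projection of [E]. *)
Definition bounds_homogeneous (R : realType) (E : set (R * R)) (u : R)
    (L : \bar R) : Prop :=
  forall (J : finType) (c d : R) (t : J -> R * R) (y : R),
    carpet_system (fun=> c) (fun=> d) t E -> 0 < c < 1 -> 0 < d < 1 ->
    d <= c -> 1 <= #|J|%:R * (c `^ u * d `^ y) -> ((y + u)%:E <= L)%E.

Section pressure_bounds.
Variables (R : realType) (I : finType) (c d : I -> R) (t : I -> R * R).
Variables (E : set (R * R)) (L : \bar R) (t1 t2 : R).
Hypothesis I0 : (0 < #|I|)%N.
Hypotheses (c01 : forall i, 0 < c i < 1) (d01 : forall i, 0 < d i < 1).
Hypothesis hE : carpet_system c d t E.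
Hypothesis hA : bounds_homogeneous E t1 L.

Let c0 i : 0 < c i. Proof. by have /andP[] := c01 i. Qed.
Let c1 i : c i < 1. Proof. by have /andP[] := c01 i. Qed.
Let d0 i : 0 < d i. Proof. by have /andP[] := d01 i. Qed.
Let d1 i : d i < 1. Proof. by have /andP[] := d01 i. Qed.

Lemma wide_pressure_bound : (forall i, d i <= c i) ->
  ((pressure_root c d t1)%:E <= L)%E.
Proof.
move=> dc; apply: lee_dense => s; rewrite lte_fin.
move=> /(pressure_gt1 I0 c0 d01) /(homogeneous_subsystem hE c1 d1).
move=> [J [c' [d' [t' [hJ [hc' hd'] h1 dc' _]]]]].
by have := hA hJ hc' hd' (dc' dc) h1; rewrite subrK.
Qed.

Hypothesis hB : bounds_homogeneous (transpose @` E) t2 L.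

(** The weights [c ^ x * d ^ (s - x)] with [x] between [s - t2] and [t1] are at
    most the weight that governs the orientation of the rectangle, whichever
    it is; so either orientation of the homogeneous subsystem gives [s]. *)
Lemma tilted_pressure_bound (s x : R) : s - t2 <= x -> x <= t1 ->
  1 < \sum_i c i `^ x * d i `^ (s - x) -> (s%:E <= L)%E.
Proof.
move=> sx xt /(homogeneous_subsystem hE c1 d1).
move=> [J [c' [d' [t' [hJ [hc' hd'] h1 _ _]]]]].
have c'0 : 0 < c' by have /andP[] := hc'.
have d'0 : 0 < d' by have /andP[] := hd'.
have [dc|/ltW cd] := leP d' c'.
  rewrite -[s](subrK t1); apply: (hA hJ hc' hd' dc).
  by apply: le_trans h1 _; rewrite ler_wpM2l// tilt_le.
rewrite -[s](subrK t2); apply: (hB (carpet_system_transpose hJ) hd' hc' cd).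
apply: le_trans h1 _; rewrite ler_wpM2l//.
have sxt : s - x <= t2 by move: sx; lra.
by have := tilt_le s c'0 cd sxt; rewrite subKr mulrC.
Qed.

Lemma mixed_pressure_bound : pressure_root c d t1 <= t1 + t2 ->
  pressure_root d c t2 <= t1 + t2 ->
  (maxe (pressure_root c d t1)%:E (pressure_root d c t2)%:E <= L)%E.
Proof.
move=> hAt hBt; rewrite ge_max; apply/andP; split.
  apply: lee_dense => s; rewrite lte_fin => hs.
  apply: (@tilted_pressure_bound s t1) => //; last exact: pressure_gt1 hs.
  by rewrite lerBlDr; apply: le_trans hAt; exact: ltW.
apply: lee_dense => s; rewrite lte_fin => hs.
apply: (@tilted_pressure_bound s (s - t2)) => //.
  by rewrite lerBlDr; apply: le_trans hBt; exact: ltW.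
under eq_bigr do rewrite subKr mulrC.
exact: pressure_gt1 hs.
Qed.

End pressure_bounds.

Lemma sum_injective_le (R : realType) (I K : finType) (h : I -> K) (F : K -> R) :
  injective h -> (forall k, 0 <= F k) -> \sum_i F (h i) <= \sum_k F k.
Proof.
move=> hinj F0.
have /= e := big_imset F (A := predT) (in2W hinj) (aop := +%R).
rewrite [leRHS](bigID (fun k => k \in imset h (mem predT)))/= -e.
by rewrite lerDl sumr_ge0.
Qed.

(** * Dimensions of wide and of mixed carpets *)

Lemma lee_dense_above (R : realType) (x y : \bar R) :
  (forall b : R, (y < b%:E)%E -> (x <= b%:E)%E) -> (x <= y)%E.
Proof.
move=> h; apply: lee_dense => b bx; rewrite leNgt; apply/negP => yb.
have [e /andP[ye eb]] : exists e : R, (y < e%:E)%E && (e < b).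
  case: y yb {h} => [y| |]//.
    by rewrite lte_fin => yb; exists ((y + b) / 2); rewrite lte_fin; apply/andP; split; lra.
  by move=> _; exists (b - 1); rewrite ltNyr; lra.
have := le_lt_trans (h e ye) (_ : (e%:E < b%:E)%E); rewrite lte_fin => /(_ eb).
by rewrite ltNge (ltW bx).
Qed.

Lemma lee_max_dense (R : realType) (a b : R) (x y : \bar R) :
  (forall beta : R, a < beta -> b < beta -> (y < beta%:E)%E ->
     (x <= beta%:E)%E) ->
  (x <= maxe (maxe a%:E b%:E) y)%E.
Proof.
move=> h; apply: lee_dense_above => beta; rewrite !gt_max !lte_fin.
by move=> /andP[/andP[? ?] ?]; exact: h.
Qed.

Lemma common_margin (R : realType) (a b beta : R) : a < beta -> b < beta ->
  exists e, [/\ 0 < e, a < beta - e & b < beta - e].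
Proof.
move=> ab bb; exists (Num.min ((beta - a) / 2) ((beta - b) / 2)).
have h1 : Num.min ((beta - a) / 2) ((beta - b) / 2) <= (beta - a) / 2.
  by rewrite ge_min lexx.
have h2 : Num.min ((beta - a) / 2) ((beta - b) / 2) <= (beta - b) / 2.
  by rewrite ge_min lexx orbT.
by split; [rewrite lt_min !divr_gt0// subr_gt0|lra|lra].
Qed.

(** Since [c i < 1], the exponent of [c] may exceed [u] by [e] at the price of
    a loss [e] in [s]. *)
Lemma pressure_shift (R : realType) (I : finType) (c d : I -> R) (u e s : R) :
  (forall i, 0 < c i < 1) -> 0 <= e ->
  \sum_i c i `^ (u + e) * d i `^ (s - (u + e)) <=
  \sum_i c i `^ u * d i `^ (s - e - u).
Proof.
move=> c01 e0; apply: ler_sum => i _; have /andP[c0 c1] := c01 i.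
rewrite opprD addrA addrAC [s - e - u]addrAC ler_wpM2r ?powR_ge0//.
by apply: ger_powR; rewrite ?lerDl// c0 ltW.
Qed.

Lemma weight_scale (R : realType) (x y c d u v : R) :
  0 < x -> 0 < y -> 0 < c -> 0 < d ->
  (x * c) `^ u * (y * d) `^ v = (c `^ u * d `^ v) * (x `^ u * y `^ v).
Proof.
move=> x0 y0 c0 d0; rewrite !powRM ?(ltW x0) ?(ltW y0) ?(ltW c0) ?(ltW d0)//.
by rewrite mulrACA mulrC.
Qed.

Section carpets.
Variables (R : realType) (I : finType) (c d : I -> R) (t : I -> R * R).
Variables (C F0 FC : set (R * R)).
Hypothesis hS : carpet_shape c d t.
Hypothesis hcol : in_columns c (fun i => (t i).1).
Hypothesis (C0 : C !=set0) (C01 : C `<=` @unit_square R).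
Hypothesis hF0 : carpet_attractor c d t set0 F0.
Hypothesis hFC : carpet_attractor c d t C FC.

Local Notation ldim := (lower_box_dim (@plane_dist R)).
Local Notation udim := (upper_box_dim (@plane_dist R)).
Local Notation A_lower := (pressure_root c d (t_lower F0 C fst)).
Local Notation A_upper := (pressure_root c d (t_upper F0 C fst)).
Local Notation B_lower := (pressure_root d c (t_lower F0 C snd)).
Local Notation B_upper := (pressure_root d c (t_upper F0 C snd)).

Let I0 := shape_nonempty hS.
Let c01 := shape_hscale hS.
Let d01 := shape_vscale hS.
Let c0 i : 0 < c i. Proof. by have /andP[] := c01 i. Qed.
Let d0 i : 0 < d i. Proof. by have /andP[] := d01 i. Qed.
Let hsys := attractor_carpet_system hS hFC.

Let CF : C `<=` FC.
Proof. by rewrite (attractorE hFC) => p Cp; right. Qed.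

Let scale_bounds : exists m M, [/\ 0 < m, 0 < M < 1, forall i, m <= c i <= M &
  forall i, m <= d i <= M].
Proof.
have [m [M [m0 M1 hc]]] := unit_interval_bounds c01.
have [m' [M' [m'0 M'1 hd]]] := unit_interval_bounds d01.
exists (Num.min m m'), (Num.max M M'); split.
- by rewrite lt_min m0.
- rewrite gt_max M1 M'1 andbT lt_max; have /card_gt0P[i _] := I0.
  by have /andP[_ /(lt_le_trans (c0 i)) ->] := hc i.
- by move=> i; have /andP[h1 h2] := hc i; rewrite ge_min h1 le_max h2.
- by move=> i; have /andP[h1 h2] := hd i; rewrite ge_min h1 le_max h2 !orbT.
Qed.

Lemma bounds_lower : bounds_homogeneous FC (t_lower F0 C fst) (ldim FC).
Proof. by move=> J c' d' t' y; exact: (homogeneous_t_lower hS hcol C0 C01 hF0 hFC). Qed.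

Lemma bounds_upper : bounds_homogeneous FC (t_upper F0 C fst) (udim FC).
Proof. by move=> J c' d' t' y; exact: (homogeneous_t_upper hS hcol C0 C01 hF0 hFC). Qed.

Lemma condensation_dims : (ldim C <= ldim FC)%E /\ (udim C <= udim FC)%E.
Proof.
by split; [exact: (lower_box_dim_sub _ CF)|exact: (upper_box_dim_sub _ CF)].
Qed.

Lemma wide_carpet_lower : (forall i, d i <= c i) ->
  (maxe A_lower%:E (ldim C) <= ldim FC)%E /\
  (maxe A_upper%:E (udim C) <= udim FC)%E.
Proof.
move=> dc; have [hl hu] := condensation_dims.
rewrite !ge_max hl hu !andbT; split.
  exact: (wide_pressure_bound I0 c01 d01 hsys bounds_lower dc).
exact: (wide_pressure_bound I0 c01 d01 hsys bounds_upper dc).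
Qed.

Lemma wide_carpet_upper : (forall i, d i <= c i) ->
  assouad_condition F0 C fst ->
  (udim FC <= maxe A_upper%:E (udim C))%E.
Proof.
move=> dc hA; apply: lee_dense_above => beta.
rewrite gt_max lte_fin => /andP[sbeta Cbeta].
have beta0 : 0 <= beta.
  rewrite -lee_fin; apply: le_trans (ltW Cbeta).
  by apply: le_trans (lower_le_upper_box_dim _ _); exact: lower_box_dim_ge0.
pose e := (beta - A_upper) / 2; have e0 : 0 < e by rewrite divr_gt0// subr_gt0.
pose u := t_upper F0 C fst + e.
have tu : t_upper F0 C fst < u by rewrite ltrDl.
pose theta := \sum_i c i `^ u * d i `^ (beta - u).
have theta1 : 0 <= theta < 1.
  rewrite sumr_ge0 => [|i _]; last by rewrite mulr_ge0 ?powR_ge0.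
  apply: le_lt_trans (pressure_shift _ _ _ c01 (ltW e0)) _.
  by apply: (pressure_lt1 I0 c0 d01); rewrite /e; move: sbeta; lra.
have [m [M [m0 M01 hc hd]]] := scale_bounds.
have [[KF KF0 hF] [KC KC0 hC]] := wide_rectangles_coverable hS hcol C0 C01 hF0
  hFC m0 M01 hc tu beta0 Cbeta hA.
apply: (@carpet_upper_box_dim R I c d t FC C m M beta theta KF KC
  (fun x y => 0 < y <= x) (fun x y => x `^ u * y `^ (beta - u))) => //.
- by rewrite ltr01 lexx.
- move=> x y i /andP[y0 yx]; rewrite mulr_gt0//= ler_pM ?(ltW y0) ?(ltW (d0 i))//.
- by move=> x y; rewrite mulr_ge0 ?powR_ge0.
- move=> x y x0 y0; rewrite /theta mulr_suml.
  by apply: ler_sum => i _; rewrite weight_scale.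
- by rewrite {1}(attractorE hFC).
- move=> x y r s /andP[y0 yx] r0 x1 y1; rewrite min_r// => /andP[ry yr].
  by apply: hF => //; rewrite ry ltW.
- move=> x y r s /andP[y0 yx] r0 x1 y1; rewrite min_r// => ry.
  by apply: hC => //; rewrite r0.
Qed.

Hypothesis hrow : in_columns d (fun i => (t i).2).

Let hS' := carpet_shape_transpose hS.
Let hF0' : carpet_attractor d c (transpose \o t) set0 (transpose @` F0).
Proof. by have := carpet_attractor_transpose hF0; rewrite image_set0. Qed.
Let hFC' := carpet_attractor_transpose hFC.
Let C0' : transpose @` C !=set0.
Proof. by have [p Cp] := C0; exists (transpose p), p. Qed.
Let C01' := unit_square_transpose C01.

Lemma t_lower_transpose :
  t_lower (transpose @` F0) (transpose @` C) fst = t_lower F0 C snd.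
Proof. by rewrite /t_lower !fst_transpose. Qed.

Lemma t_upper_transpose :
  t_upper (transpose @` F0) (transpose @` C) fst = t_upper F0 C snd.
Proof. by rewrite /t_upper !fst_transpose. Qed.

Lemma bounds_lower_transpose :
  bounds_homogeneous (transpose @` FC) (t_lower F0 C snd) (ldim FC).
Proof.
rewrite -t_lower_transpose -(lower_box_dim_transpose FC) => J c' d' t' y.
exact: (homogeneous_t_lower hS' hrow C0' C01' hF0' hFC').
Qed.

Lemma bounds_upper_transpose :
  bounds_homogeneous (transpose @` FC) (t_upper F0 C snd) (udim FC).
Proof.
rewrite -t_upper_transpose -(upper_box_dim_transpose FC) => J c' d' t' y.
exact: (homogeneous_t_upper hS' hrow C0' C01' hF0' hFC').
Qed.

(** Two maps are determined by their column and their row, so this sum is at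
    most the product of the column sum and of the row sum. *)
Lemma grid_sum_le1 u v : box_dim (@line_dist R) (fst @` F0) <= u ->
  box_dim (@line_dist R) (snd @` F0) <= v ->
  \sum_i c i `^ u * d i `^ v <= 1.
Proof.
have [K [g [a [x hK]]]] := column_model_exists hS hcol.
have [K' [g' [a' [x' hK']]]] := column_model_exists hS' hrow.
rewrite (projected_box_dim hS hK hF0) -(fst_transpose F0).
rewrite (projected_box_dim hS' hK' hF0') => au a'v.
have inj : injective (fun i => (g i, g' i)).
  move=> i j [gij g'ij]; apply/eqP; apply: contraT => ij.
  have ec : c i = c j by rewrite -!(model_scale hK) gij.
  have et : (t i).1 = (t j).1 by rewrite -!(model_shift hK) gij.
  have ed : d i = d j by rewrite -!(model_scale hK') g'ij.
  have et' : (t i).2 = (t j).2.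
    by have := model_shift hK' i; rewrite g'ij (model_shift hK' j).
  have := shape_apart hS ij; rewrite /apart ec ed et et'.
  by have := c0 j; have := d0 j; move=> ? ? [[]|[]]; lra.
have := @sum_injective_le R I (K * K')%type _ (fun p => a p.1 `^ u * a' p.2 `^ v) inj.
move=> /(_ (fun p => mulr_ge0 (powR_ge0 _ _) (powR_ge0 _ _))) /=.
under eq_bigr do rewrite (model_scale hK) (model_scale hK').
move=> /le_trans; apply.
rewrite -(pair_bigA _ (fun k l => a k `^ u * a' l `^ v))/= -big_distrlr/=.
have h1 := column_sum_le1 (model_nonempty hS g) (model_scale_range hK) au.
have h2 := column_sum_le1 (model_nonempty hS' g') (model_scale_range hK') a'v.
by apply: mulr_ile1 => //; apply: sumr_ge0 => *; exact: powR_ge0.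
Qed.

Lemma pressure_roots_le u v : box_dim (@line_dist R) (fst @` F0) <= u ->
  box_dim (@line_dist R) (snd @` F0) <= v ->
  pressure_root c d u <= u + v /\ pressure_root d c v <= u + v.
Proof.
move=> su sv; have h := grid_sum_le1 su sv; split; rewrite leNgt; apply/negP.
  move=> /(pressure_gt1 I0 c0 d01); rewrite ltNge => /negP; apply.
  by rewrite addrAC subrr add0r.
move=> /(pressure_gt1 I0 d0 c01); rewrite ltNge => /negP; apply.
by rewrite addrK; under eq_bigr do rewrite mulrC.
Qed.

Lemma mixed_carpet_lower :
  (maxe (maxe A_lower%:E B_lower%:E) (ldim C) <= ldim FC)%E /\
  (maxe (maxe A_upper%:E B_upper%:E) (udim C) <= udim FC)%E.
Proof.
have [hl hu] := condensation_dims.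
have le_t p : box_dim (@line_dist R) (p @` F0) <= t_lower F0 C p.
  by rewrite le_max lexx.
have le_t' p : box_dim (@line_dist R) (p @` F0) <= t_upper F0 C p.
  by rewrite le_max lexx.
have [a1 b1] := pressure_roots_le (le_t fst) (le_t snd).
have [a2 b2] := pressure_roots_le (le_t' fst) (le_t' snd).
split; rewrite ge_max ?hl ?hu andbT.
  exact: (mixed_pressure_bound I0 c01 d01 hsys bounds_lower bounds_lower_transpose).
exact: (mixed_pressure_bound I0 c01 d01 hsys bounds_upper bounds_upper_transpose).
Qed.

(** The recursion runs with the sum of the weights for wide and for tall
    rectangles: the cost of a rectangle of either orientation is bounded by its
    own weight, hence by the sum, and each weight is contracted. *)
Lemma mixed_upper_box_dim_le u v beta :
  t_upper F0 C fst < u -> t_upper F0 C snd < v -> (udim C < beta%:E)%E ->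
  \sum_i c i `^ u * d i `^ (beta - u) < 1 ->
  \sum_i d i `^ v * c i `^ (beta - v) < 1 ->
  assouad_condition F0 C fst -> assouad_condition F0 C snd ->
  (udim FC <= beta%:E)%E.
Proof.
set thA := \sum_i _; set thB := \sum_i _.
rewrite -t_upper_transpose => tu tv Cbeta thA1 thB1 hA hB.
have beta0 : 0 <= beta.
  rewrite -lee_fin; apply: le_trans (ltW Cbeta).
  by apply: le_trans (lower_le_upper_box_dim _ _); exact: lower_box_dim_ge0.
have thA0 : 0 <= thA by apply: sumr_ge0 => i _; rewrite mulr_ge0 ?powR_ge0.
have [m [M [m0 M01 hc hd]]] := scale_bounds.
have [[KF KF0 hF] [KC KC0 hC]] := wide_rectangles_coverable hS hcol C0 C01 hF0
  hFC m0 M01 hc tu beta0 Cbeta hA.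
have Cbeta' : (udim (transpose @` C) < beta%:E)%E.
  by rewrite upper_box_dim_transpose.
have hB' : assouad_condition (transpose @` F0) (transpose @` C) fst.
  by rewrite /assouad_condition !fst_transpose.
have [[KF' KF'0 hF'] [KC' KC'0 hC']] := wide_rectangles_coverable hS' hrow C0'
  C01' hF0' hFC' m0 M01 hd tv beta0 Cbeta' hB'.
pose wA x y := x `^ u * y `^ (beta - u); pose wB x y := y `^ v * x `^ (beta - v).
have wA0 x y : 0 <= wA x y by rewrite mulr_ge0 ?powR_ge0.
have wB0 x y : 0 <= wB x y by rewrite mulr_ge0 ?powR_ge0.
have mono (K K' r x y w : R) : 0 <= K -> 0 <= K' -> (w <= wA x y \/ w <= wB x y) ->
    K * r `^ (- beta) * w <= (K + K') * r `^ (- beta) * (wA x y + wB x y).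
  move=> k0 k0' hw; have rb := powR_ge0 r (- beta).
  have {}hw : w <= wA x y + wB x y.
    by case: hw => /le_trans; apply; rewrite ?lerDl ?lerDr.
  apply: (@le_trans _ _ (K * r `^ (- beta) * (wA x y + wB x y))).
    by rewrite ler_wpM2l// mulr_ge0.
  by rewrite ler_wpM2r ?addr_ge0// ler_wpM2r// lerDl.
apply: (@carpet_upper_box_dim R I c d t FC C m M beta (Num.max thA thB)
  (KF + KF') (KC + KC') (fun x y => 0 < x /\ 0 < y)
  (fun x y => wA x y + wB x y)) => //.
- by rewrite le_max thA0 gt_max thA1.
- by rewrite addr_ge0.
- by rewrite addr_ge0.
- by move=> x y i [x0 y0]; rewrite !mulr_gt0.
- by move=> x y; rewrite addr_ge0.
- move=> x y x0 y0; rewrite big_split/= mulrDr; apply: lerD.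
    apply: (@le_trans _ _ (thA * wA x y)).
      by rewrite /thA mulr_suml; apply: ler_sum => i _; rewrite /wA weight_scale.
    by rewrite ler_wpM2r// le_max lexx.
  apply: (@le_trans _ _ (thB * wB x y)).
    by rewrite /thB mulr_suml; apply: ler_sum => i _; rewrite /wB weight_scale.
  by rewrite ler_wpM2r// le_max lexx orbT.
- by rewrite {1}(attractorE hFC).
- move=> x y r s [x0 y0] r0 x1 y1; have [xy|yx] := leP x y => /andP[rx xr].
    apply: coverable_diag_transpose.
    apply: coverable_mono (hF' y x r (transpose s) r0 xy _) => //.
      by rewrite [KF + _]addrC mono//; right.
    by rewrite rx ltW.
  apply: coverable_mono (hF x y r s r0 (ltW yx) _) => //.
    by rewrite mono//; left.
  by rewrite rx ltW.
- move=> x y r s [x0 y0] r0 x1 y1; have [xy|yx] := leP x y => rx.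
    apply: coverable_diag_transpose.
    apply: coverable_mono (hC' y x r (transpose s) _ xy y1) => //.
      by rewrite [KC + _]addrC mono//; right.
    by rewrite r0.
  apply: coverable_mono (hC x y r s _ (ltW yx) x1) => //.
    by rewrite mono//; left.
  by rewrite r0.
Qed.


Lemma mixed_carpet_upper :
  assouad_condition F0 C fst -> assouad_condition F0 C snd ->
  (udim FC <= maxe (maxe A_upper%:E B_upper%:E) (udim C))%E.
Proof.
move=> hA hB; apply: lee_max_dense => beta Abeta Bbeta Cbeta.
have [e [e0 Ae Be]] := common_margin Abeta Bbeta.
apply: (@mixed_upper_box_dim_le (t_upper F0 C fst + e) (t_upper F0 C snd + e)) => //.
- by rewrite ltrDl.
- by rewrite ltrDl.
- apply: le_lt_trans (pressure_shift _ _ _ c01 (ltW e0)) _.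
  exact: (pressure_lt1 I0 c0 d01 Ae).
- apply: le_lt_trans (pressure_shift _ _ _ d01 (ltW e0)) _.
  exact: (pressure_lt1 I0 d0 c01 Be).
Qed.

End carpets.

(** * Lalley-Gatzouras and Baranski systems *)

Section slicing_facts.
Variables (R : realType) (s : seq R).
Hypothesis hs : is_slicing s.

Lemma slice_point_mono k l : (k <= l)%N -> (l <= (size s).+1)%N ->
  slice_point s k <= slice_point s l.
Proof.
move=> kl ls; rewrite /slice_point.
have srt : sorted <=%R (0 :: rcons s 1).
  by move: hs; rewrite /is_slicing /=; apply: sub_path => x y /ltW.
apply: (sorted_leq_nth le_trans le_refl 1 srt) => //; rewrite inE /= size_rcons ltnS//.
exact: leq_trans ls.
Qed.

Lemma slices_apart k l : (k <= size s)%N -> (l <= size s)%N -> k != l ->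
  apart (slice_length s k) (slice_point s k) (slice_length s l) (slice_point s l).
Proof.
move=> ks ls; rewrite neq_ltn => /orP[kl|lk]; [left|right];
  rewrite addrC subrK slice_point_mono//; exact: leqW.
Qed.

End slicing_facts.

Lemma diag_map_square_image (R : realType) (c d : R) (t : R * R) (a b a' b' : R) :
  0 < c -> 0 < d ->
  diag_map c d t @` @unit_square R = `[a, b] `*` `[a', b'] ->
  [/\ t.1 = a, c = b - a, t.2 = a' & d = b' - a'].
Proof.
move=> c0 d0 e.
have sq (p : R * R) : 0 <= p.1 <= 1 -> 0 <= p.2 <= 1 -> @unit_square R p.
  by split; rewrite /= in_itv.
have img p : @unit_square R p -> (`[a, b] `*` `[a', b']) (diag_map c d t p).
  by rewrite -e => hp; exists p.
have pre p : (`[a, b] `*` `[a', b']) p ->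
    [/\ t.1 <= p.1, p.1 <= c + t.1, t.2 <= p.2 & p.2 <= d + t.2].
  rewrite -e => -[q [/=]]; rewrite !in_itv/= => /andP[q10 q11] /andP[q20 q21] <-.
  rewrite /diag_map/= lerDr lerD2r lerDr lerD2r.
  by rewrite ?mulr_ge0 ?ler_piMr// ltW.
have sq0 : @unit_square R (0, 0) by apply: sq; rewrite lexx ler01.
have sq1 : @unit_square R (1, 1) by apply: sq; rewrite lexx ler01.
have [/=] := img _ sq0; rewrite !in_itv/= !mulr0 !add0r => /andP[a1 a2] /andP[a3 a4].
have [/=] := img _ sq1; rewrite !in_itv/= !mulr1 => /andP[a5 a6] /andP[a7 a8].
have ab := le_trans a1 a2; have ab' := le_trans a3 a4.
have [|h1 _ h2 _] := pre (a, a'); first by split; rewrite /= in_itv/= lexx.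
have [|_ h3 _ h4] := pre (b, b'); first by split; rewrite /= in_itv/= lexx andbT.
move: h1 h2 h3 h4 => /= h1 h2 h3 h4.
by split; apply/le_anti/andP; split; lra.
Qed.

Section carpets_of_systems.
Variables (R : realType) (I : finType) (S : diagonal_ifs R I).

Local Notation c := (hscale S).
Local Notation d := (vscale S).
Local Notation t := (Defs.shift S).

Lemma diagonal_ifs_square i : [/\ 0 <= (t i).1, (t i).1 + c i <= 1,
  0 <= (t i).2 & (t i).2 + d i <= 1].
Proof.
have sq (z : R) : 0 <= z <= 1 -> @unit_square R (diag_map (c i) (d i) (t i) (z, z)).
  move=> hz; apply: (@diag_ifs_square R I S i).
  by exists (z, z) => //; split; rewrite /= in_itv.
have [/=] := sq 0 ltac:(by rewrite lexx ler01).
rewrite !in_itv/= !mulr0 !add0r => /andP[h1 _] /andP[h2 _].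
have [/=] := sq 1 ltac:(by rewrite lexx ler01).
rewrite !in_itv/= !mulr1 => /andP[_ h3] /andP[_ h4].
by split=> //; rewrite addrC.
Qed.

Lemma carpet_attractor_of C F : C `<=` @unit_square R -> is_attractor S C F ->
  carpet_attractor c d t C F.
Proof.
move=> C01 [F0 cF FE]; split => //.
have proj_sub (p : R * R -> R) (a x : I -> R) :
    (forall i q, p (ifs_map S i q) = a i * p q + x i) -> p @` F `<=`
    (\bigcup_(i in [set: I]) ((fun y => a i * y + x i) @` (p @` F))) `|` p @` C.
  move=> hp _ [q Fq <-]; move: Fq; rewrite {1}FE => -[[i _ [r Fr <-]]|Cq].
    by left; exists i => //; exists (p r); [exists r|rewrite hp].
  by right; exists q.
have sq := diagonal_ifs_square.
have F1 : fst @` F `<=` `[0, 1].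
  have [ub lb] := compact_fst_bounded cF.
  apply: (attractor_unit_interval (hscale_range S) ub lb _ _ (proj_sub fst c _ _)) => //.
  - by move=> i; have [] := sq i.
  - exact: fst_unit_interval.
have F2 : snd @` F `<=` `[0, 1].
  have [ub lb] := compact_snd_bounded cF.
  apply: (attractor_unit_interval (vscale_range S) ub lb _ _ (proj_sub snd d _ _)) => //.
  - by move=> i; have [] := sq i.
  - by move=> _ [p /C01[_ +] <-].
by move=> p Fp; split; [apply: F1|apply: F2]; exists p.
Qed.

Hypothesis I2 : (1 < #|I|)%N.

Lemma carpet_shape_of :
  (forall i j, i != j -> apart (c i) (t i).1 (c j) (t j).1 \/
    apart (d i) (t i).2 (d j) (t j).2) -> carpet_shape c d t.
Proof.
move=> h; split=> //.
- exact: ltnW.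
- exact: hscale_range.
- exact: vscale_range.
- exact: diagonal_ifs_square.
Qed.

Lemma image_rectangle i (a b a' b' : R) :
  ifs_map S i @` @unit_square R = `[a, b] `*` `[a', b'] ->
  [/\ (t i).1 = a, c i = b - a, (t i).2 = a' & d i = b' - a'].
Proof.
have /andP[c0 _] := hscale_range S i; have /andP[d0 _] := vscale_range S i.
exact: diag_map_square_image.
Qed.

Lemma lalley_gatzouras_carpet : lalley_gatzouras S ->
  [/\ carpet_shape c d t, in_columns c (fun i => (t i).1) &
      forall i, d i <= c i].
Proof.
move=> [v [h [f [[_ hv] hh finj fsize himg]]]].
have rect i := image_rectangle (himg i).2.
have col i j : (f i).1 != (f j).1 -> apart (c i) (t i).1 (c j) (t j).1.
  move=> ij; have [-> -> _ _] := rect i; have [-> -> _ _] := rect j.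
  by apply: (slices_apart hv _ _ ij); [case: (fsize i)|case: (fsize j)].
split.
- apply: carpet_shape_of => i j ij.
  have [e|/col] := eqVneq (f i).1 (f j).1; [right|by left].
  have [_ _ -> ->] := rect i; have [_ _ -> ->] := rect j.
  have [hi1 hi2] := fsize i; have [hj1 hj2] := fsize j.
  rewrite e in hi2 *; apply: (slices_apart (hh _ hj1)) => //.
  apply: contraNneq ij => e2; apply/eqP/finj.
  by rewrite [f i]surjective_pairing [f j]surjective_pairing e e2.
- move=> i j; have [e|/col] := eqVneq (f i).1 (f j).1; [left|by right].
  have [-> -> _ _] := rect i; have [-> -> _ _] := rect j.
  by rewrite e.
- move=> i; have [_ -> _ ->] := rect i; exact: (himg i).1.
Qed.

Lemma baranski_carpet : baranski S ->
  [/\ carpet_shape c d t, in_columns c (fun i => (t i).1) &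
      in_columns d (fun i => (t i).2)].
Proof.
move=> [v [h [f [[_ hv _ hh] finj himg _ _]]]].
have rect i : [/\ (t i).1 = slice_point v (f i).1, c i = slice_length v (f i).1,
    (t i).2 = slice_point h (f i).2 & d i = slice_length h (f i).2].
  by have [_ _ /image_rectangle] := himg i.
have col i j : (f i).1 != (f j).1 -> apart (c i) (t i).1 (c j) (t j).1.
  move=> ij; have [-> -> _ _] := rect i; have [-> -> _ _] := rect j.
  by apply: (slices_apart hv _ _ ij); [case: (himg i)|case: (himg j)].
have row i j : (f i).2 != (f j).2 -> apart (d i) (t i).2 (d j) (t j).2.
  move=> ij; have [_ _ -> ->] := rect i; have [_ _ -> ->] := rect j.
  by apply: (slices_apart hh _ _ ij); [case: (himg i)|case: (himg j)].
split.
- apply: carpet_shape_of => i j ij.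
  have [e1|/col] := eqVneq (f i).1 (f j).1; [right|by left].
  apply: row; apply: contraNneq ij => e2; apply/eqP/finj.
  by rewrite [f i]surjective_pairing [f j]surjective_pairing e1 e2.
- move=> i j; have [e|/col] := eqVneq (f i).1 (f j).1; [left|by right].
  by have [-> -> _ _] := rect i; have [-> -> _ _] := rect j; rewrite e.
- move=> i j; have [e|/row] := eqVneq (f i).2 (f j).2; [left|by right].
  by have [_ _ -> ->] := rect i; have [_ _ -> ->] := rect j; rewrite e.
Qed.

End carpets_of_systems.

Local Open Scope ereal_scope.

Theorem theorem2p1 (R : realType) (I : finType) (S : diagonal_ifs R I)
    (C F0 FC : set (R * R)) :
  (1 < #|I|)%N ->
  lalley_gatzouras S \/ baranski S ->
  C `<=` @unit_square R -> C !=set0 -> compact C ->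
  is_attractor S set0 F0 ->
  is_attractor S C FC ->
  let ldim := lower_box_dim (@plane_dist R) in
  let udim := upper_box_dim (@plane_dist R) in
  let sA_lo := (sA_lower S F0 C)%:E in
  let sA_up := (sA_upper S F0 C)%:E in
  let sB_lo := (sB_lower S F0 C)%:E in
  let sB_up := (sB_upper S F0 C)%:E in
  (assouad_condition F0 C fst /\ assouad_condition F0 C snd ->
     (lalley_gatzouras S ->
        [/\ maxe sA_lo (ldim C) <= ldim FC,
            ldim FC <= udim FC &
            udim FC = maxe sA_up (udim C)]) /\
     (baranski S ->
        [/\ maxe (maxe sA_lo sB_lo) (ldim C) <= ldim FC,
            ldim FC <= udim FC &
            udim FC = maxe (maxe sA_up sB_up) (udim C)])) /\
  (lalley_gatzouras S ->
     [/\ maxe sA_lo (ldim C) <= ldim FC,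
         ldim FC <= udim FC &
         maxe sA_up (udim C) <= udim FC]) /\
  (baranski S ->
     [/\ maxe (maxe sA_lo sB_lo) (ldim C) <= ldim FC,
         ldim FC <= udim FC &
         maxe (maxe sA_up sB_up) (udim C) <= udim FC]).
Proof.
move=> I2 _ C01 C0 _ aF0 aFC ldim udim sA_lo sA_up sB_lo sB_up.
have hF0 : carpet_attractor (hscale S) (vscale S) (Defs.shift S) set0 F0.
  by apply: carpet_attractor_of aF0 => p [].
have hFC := carpet_attractor_of C01 aFC.
have lu : ldim FC <= udim FC := lower_le_upper_box_dim _ _.
have lg : lalley_gatzouras S ->
    [/\ maxe sA_lo (ldim C) <= ldim FC, maxe sA_up (udim C) <= udim FC &
      assouad_condition F0 C fst -> udim FC <= maxe sA_up (udim C)].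
  move=> /(lalley_gatzouras_carpet I2)[hS hcol dc].
  have [lo up] := wide_carpet_lower hS hcol C0 C01 hF0 hFC dc.
  by split=> //; exact: (wide_carpet_upper hS hcol C0 C01 hF0 hFC dc).
have bar : baranski S ->
    [/\ maxe (maxe sA_lo sB_lo) (ldim C) <= ldim FC,
      maxe (maxe sA_up sB_up) (udim C) <= udim FC &
      assouad_condition F0 C fst -> assouad_condition F0 C snd ->
      udim FC <= maxe (maxe sA_up sB_up) (udim C)].
  move=> /(baranski_carpet I2)[hS hcol hrow].
  have [lo up] := mixed_carpet_lower hS hcol C0 C01 hF0 hFC hrow.
  by split=> //; exact: (mixed_carpet_upper hS hcol C0 C01 hF0 hFC hrow).
split=> [[hA hB]|]; split=> [/lg|/bar] [lo up hup]; split=> //.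
  by apply/le_anti; rewrite up hup.
by apply/le_anti; rewrite up hup.
Qed.
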